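(* Assume that one of the hypotheses (Sub), (Sup-1), (Sup-0), (Crit-1), (Crit-2), (Crit-3) described in the context holds. For $K\in\mathbb N$ let $\tilde\nu_K:=\liminf_{N\to\infty}\frac1N\mathbb E_N\big(\sum_{j>K}jC_j\big)$ and $\tilde\nu:=\lim_{K\to\infty}\tilde\nu_K$. Then for each $K\in\mathbb N$ the limit $\lim_{N\to\infty}\frac1N\mathbb E_N\big(\sum_{j>K}jC_j\big)$ exists and $$\tilde\nu_K=\lim_{N\to\infty}\frac1N\mathbb E_N\Big(\sum_{j>K}jC_j\Big)=1-\sum_{j=1}^K\kappa_j r_*^j,$$ and moreover $\tilde\nu=0$ if $g_\kappa^{\{1\}}(R)\ge1$, while $\tilde\nu=1-g_\kappa^{\{1\}}(R)>0$ if $g_\kappa^{\{1\}}(R)<1$.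
   Context: Model: for $N\in\mathbb N$, $S_N$ is the symmetric group on $\{1,\dots,N\}$; for $\sigma\in S_N$, $C_j=C_j(\sigma)$ is the number of cycles of length $j$ in $\sigma$. Given sequences of nonnegative reals $(\theta_j)_{j\ge1}$, $(\kappa_j)_{j\ge1}$, the probability measure $\mathbb P_N$ on $S_N$ is $\mathbb P_N(\sigma)=\frac{1}{N!H_N}\prod_{j=1}^N(\theta_j+N\kappa_j)^{C_j}$ with $H_N=\frac1{N!}\sum_{\sigma\in S_N}\prod_{j=1}^N(\theta_j+N\kappa_j)^{C_j}$; $\mathbb E_N$ is the expectation. Generating functions: $g_\theta(z)=\sum_{j\ge1}\theta_jz^j/j$, $g_\kappa(z)=\sum_{j\ge1}\kappa_jz^j/j$. For a function $g$, $g^{\{n\}}(z):=z^n g^{(n)}(z)$. $R\in(0,\infty]$ is the radius of convergence of $g_\kappa$, and $g_\kappa^{\{n\}}(R):=\lim_{r\uparrow R}g_\kappa^{\{n\}}(r)\in[0,\infty]$. Standing assumption: $(\kappa_j)$ is non-arithmetic (there is no integer $j_0>1$ such that $\kappa_j\ne0$ implies that $j_0$ divides $j$) and $\kappa_j>0$ for some $j\ge2$. For $\eta>0$, $\varphi\in(0,\pi/2)$, $\Delta_0=\{z\in\mathbb C:|z|<R|1+\eta e^{i\varphi}|,\ z\ne R,\ |\arg(z-R)|>\varphi\}$; ''holomorphic in some $\Delta_0$'' means for some such $\eta,\varphi$. Logarithms and non-integer powers of $1-z/R$ use principal branches. Hypotheses: (Sub) $g_\theta,g_\kappa$ both have radius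 of convergence $R>0$ and $1<g_\kappa^{\{1\}}(R)\le\infty$. (Sup-1) $g_\theta,g_\kappa$ both have radius of convergence $R>0$, are holomorphic in some $\Delta_0$, $g_\kappa^{\{1\}}(R)<1$, and as $z\to R$, $z\in\Delta_0$: $g_\theta(z)=-\theta^*\log(1-z/R)+O((1-z/R)^\delta)$ and $g_\kappa(z)=g_\kappa(R)-g_\kappa^{\{1\}}(R)(1-z/R)+O((1-z/R)^{1+\delta})$, for some $\theta^*>0$, $\delta>0$. (Sup-0) $g_\kappa$ has radius of convergence $R>0$ and is holomorphic in some $\Delta_0$, $g_\kappa^{\{1\}}(R)<1$, there is a non-integer $s>1$ with $g_\kappa^{\{n\}}(R)<\infty$ for all integers $n<s$ and $g_\kappa^{\{n\}}(R)=\infty$ for $n>s$, and as $z\to R$, $z\in\Delta_0$, $g_\kappa(z)=\sum_{0\le n<s}\frac{(-1)^ng_\kappa^{\{n\}}(R)}{n!}(1-z/R)^n+a_s(1-z/R)^s+O((1-z/R)^{s+\delta})$ with $a_s>0$, $\delta>0$; $g_\theta$ is holomorphic in $\Delta_0$ and regular (holomorphic in a neighbourhood of) at $z=R$. (Crit-1) $g_\theta,g_\kappa$ both have radius of convergence $R>0$, $g_\theta(R)<\infty$, $g_\kappa(R)<\infty$, $g_\kappa^{\{1\}}(R)=1$, $0<g_\kappa^{\{2\}}(R)<\infty$. (Crit-2) $g_\theta,g_\kappa$ both have radius of convergence $R>0$ and are holomorphic in some $\Delta_0$, $g_\kappa^{\{1\}}(R)=1$, $0<g_\kappa^{\{2\}}(R)<\infty$,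 and as $z\to R$, $z\in\Delta_0$: $g_\theta(z)=-\theta^*\log(1-z/R)+O((1-z/R)^\delta)$ with $\theta^*\ge0$, $\delta>0$, and $g_\kappa(z)=g_\kappa(R)-(1-z/R)+\frac12 g_\kappa^{\{2\}}(R)(1-z/R)^2+O((1-z/R)^{2+\delta})$. (Crit-3) as (Crit-2) but without the condition on $g_\kappa^{\{2\}}(R)$ and with the expansion of $g_\kappa$ replaced by $g_\kappa(z)=g_\kappa(R)-(1-z/R)+a_s(1-z/R)^s+O((1-z/R)^{s+\delta})$ with $s\in(1,2)$, $a_s>0$. Definition of $r_*$: if $g_\kappa^{\{1\}}(R)\ge1$, $r_*=r_1$, the unique $r\in(0,R]$ with $g_\kappa^{\{1\}}(r)=1$; if $g_\kappa^{\{1\}}(R)<1$, $r_*=R$. *)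

(* Defs.v *)
From mathcomp Require Import ssreflect ssrbool ssrfun eqtype ssrnat seq choice
  fintype div finset fingroup perm.
From Stdlib Require Import Reals.
From Coquelicot Require Import Coquelicot.

Set Implicit Arguments.
Unset Strict Implicit.

Local Open Scope R_scope.

Definition Ccount (N j : nat) (s : 'S_N) : nat :=
  #|[set c in porbits s | #|c| == j]|.

Definition prodR (l : seq R) : R := List.fold_right Rmult 1 l.
Definition sumR (l : seq R) : R := List.fold_right Rplus 0 l.

Definition weight (theta kappa : nat -> R) (N : nat) (s : 'S_N) : R :=
  prodR [seq (theta j + INR N * kappa j) ^ (Ccount j s) | j <- seq.iota 1 N].

Definition sumS (N : nat) (f : 'S_N -> R) : R := sumR [seq f s | s <- enum {: 'S_N}].

Definition PN (theta kappa : nat -> R) (N : nat) (s : 'S_N) : R :=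
  weight theta kappa s / sumS (weight theta kappa (N:=N)).

Definition EN (theta kappa : nat -> R) (N : nat) (X : 'S_N -> R) : R :=
  sumS (fun s => X s * PN theta kappa s).

(* (1/N) E_N( sum_{j>K} j C_j ) ; C_j = 0 for j > N *)
Definition tailmass (theta kappa : nat -> R) (K N : nat) : R :=
  / INR N * EN theta kappa
    (fun s : 'S_N => sumR [seq INR j * INR (Ccount j s) | j <- seq.iota K.+1 (N - K)]).

Definition coef (a : nat -> R) (j : nat) : R := if j is 0 then 0 else a j / INR j.

Definition g (a : nat -> R) (x : R) : R := PSeries (coef a) x.

Definition gbr (a : nat -> R) (n : nat) (r : R) : R := r ^ n * Derive_n (g a) n r.

Definition at_left_Rbar (Rad : Rbar) : (R -> Prop) -> Prop :=
  match Rad with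
  | Finite r => at_left r
  | p_infty => Rbar_locally p_infty
  | m_infty => Rbar_locally m_infty
  end.

Definition gbR (a : nat -> R) (Rad : Rbar) (n : nat) (l : Rbar) : Prop :=
  filterlim (gbr a n) (at_left_Rbar Rad) (Rbar_locally l).

Definition non_arithmetic (kappa : nat -> R) : Prop :=
  ~ (exists j0 : nat, leq 2 j0 /\
       forall j : nat, leq 1 j -> kappa j <> 0 -> dvdn j0 j).

Local Open Scope C_scope.

Definition Carg (z : C) : R :=
  let x := fst z in let y := snd z in
  if Rlt_dec 0 x then atan (y / x)
  else if Rlt_dec x 0 then
         (if Rle_dec 0 y then atan (y / x) + PI else atan (y / x) - PI)%R
  else if Rlt_dec 0 y then (PI / 2)%R
  else if Rlt_dec y 0 then (- (PI / 2))%R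
  else 0%R.

Definition Cexp (z : C) : C := (exp (fst z) * cos (snd z), exp (fst z) * sin (snd z))%R.
Definition Clog (z : C) : C := (ln (Cmod z), Carg z).
Definition Cpow (w : C) (s : R) : C := Cexp (RtoC s * Clog w).

Definition Delta0 (Rr eta phi : R) (z : C) : Prop :=
  (Cmod z < Rr * Cmod (1 + RtoC eta * (cos phi, sin phi)))%R /\
  z <> RtoC Rr /\ (phi < Rabs (Carg (z - RtoC Rr)))%R.

Definition holo_ext (a : nat -> R) (Rr eta phi : R) (G : C -> C) : Prop :=
  (forall z, Delta0 Rr eta phi z -> ex_derive G z) /\
  (forall z, (Cmod z < Rr)%R -> is_pseries (fun j => RtoC (coef a j)) z (G z)).

Definition bigO_at (Rr eta phi : R) (f : C -> C) (e : R) : Prop :=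
  exists M eps : R, (0 < eps)%R /\
    forall z, Delta0 Rr eta phi z -> (Cmod (z - RtoC Rr) < eps)%R ->
      (Cmod (f z) <= M * Cmod (Cpow (1 - z / RtoC Rr) e))%R.

Definition admissible (eta phi : R) : Prop := (0 < eta)%R /\ (0 < phi < PI / 2)%R.

Local Close Scope C_scope.

Definition Hyp_Sub (theta kappa : nat -> R) (Rad g1R : Rbar) : Prop :=
  CV_radius (coef theta) = Rad /\ CV_radius (coef kappa) = Rad /\
  Rbar_lt 0 Rad /\ Rbar_lt 1 g1R.

Definition Hyp_Sup1 (theta kappa : nat -> R) (Rad g1R : Rbar) : Prop :=
  exists Rr eta phi : R, exists Gth Gka : C -> C,
  Rad = Finite Rr /\ 0 < Rr /\
  CV_radius (coef theta) = Rad /\ CV_radius (coef kappa) = Rad /\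
  admissible eta phi /\ holo_ext theta Rr eta phi Gth /\ holo_ext kappa Rr eta phi Gka /\
  exists c1 c0 thst delta : R,
    g1R = Finite c1 /\ c1 < 1 /\ gbR kappa Rad 0 (Finite c0) /\
    0 < thst /\ 0 < delta /\
    bigO_at Rr eta phi
      (fun z => (Gth z - (- RtoC thst * Clog (1 - z / RtoC Rr)))%C) delta /\
    bigO_at Rr eta phi
      (fun z => (Gka z - (RtoC c0 - RtoC c1 * (1 - z / RtoC Rr)))%C) (1 + delta).

(* (Sup-0); the non-integer s > 1 is encoded by m < s < m + 1 with m : nat,
   so that the integers n < s are exactly n = 0, ..., m *)
Definition Hyp_Sup0 (theta kappa : nat -> R) (Rad g1R : Rbar) : Prop :=
  exists Rr eta phi : R, exists Gth Gka : C -> C,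
  Rad = Finite Rr /\ 0 < Rr /\
  CV_radius (coef kappa) = Rad /\
  admissible eta phi /\ holo_ext kappa Rr eta phi Gka /\
  exists c1 : R, g1R = Finite c1 /\ c1 < 1 /\
  exists (s : R) (m : nat) (cn : nat -> R) (a_s delta : R),
    1 < s /\ INR m < s < INR m + 1 /\
    (forall n : nat, INR n < s -> gbR kappa Rad n (Finite (cn n))) /\
    (forall n : nat, s < INR n -> gbR kappa Rad n p_infty) /\
    0 < a_s /\ 0 < delta /\
    bigO_at Rr eta phi
      (fun z => (Gka z -
         (List.fold_right Cplus (RtoC 0)
            [seq RtoC ((-1) ^ n * cn n / INR (Factorial.fact n)) * Cpow (1 - z / RtoC Rr) (INR n)
            | n <- seq.iota 0 m.+1]
          + RtoC a_s * Cpow (1 - z / RtoC Rr) s))%C) (s + delta) /\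
    holo_ext theta Rr eta phi Gth /\
    exists rho : R, 0 < rho /\ forall z, Cmod (z - RtoC Rr) < rho -> ex_derive Gth z.

Definition Hyp_Crit1 (theta kappa : nat -> R) (Rad g1R : Rbar) : Prop :=
  CV_radius (coef theta) = Rad /\ CV_radius (coef kappa) = Rad /\ Rbar_lt 0 Rad /\
  (exists c, gbR theta Rad 0 (Finite c)) /\ (exists c, gbR kappa Rad 0 (Finite c)) /\
  g1R = Finite 1 /\ (exists c2, 0 < c2 /\ gbR kappa Rad 2 (Finite c2)).

Definition Crit_common (theta kappa : nat -> R) (Rad g1R : Rbar)
  (Rr eta phi : R) (Gth Gka : C -> C) : Prop :=
  Rad = Finite Rr /\ 0 < Rr /\
  CV_radius (coef theta) = Rad /\ CV_radius (coef kappa) = Rad /\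
  admissible eta phi /\ holo_ext theta Rr eta phi Gth /\ holo_ext kappa Rr eta phi Gka /\
  g1R = Finite 1.

Definition Hyp_Crit2 (theta kappa : nat -> R) (Rad g1R : Rbar) : Prop :=
  exists Rr eta phi : R, exists Gth Gka : C -> C,
  Crit_common theta kappa Rad g1R Rr eta phi Gth Gka /\
  exists c0 c2 thst delta : R,
    gbR kappa Rad 0 (Finite c0) /\ gbR kappa Rad 2 (Finite c2) /\ 0 < c2 /\
    0 <= thst /\ 0 < delta /\
    bigO_at Rr eta phi
      (fun z => (Gth z - (- RtoC thst * Clog (1 - z / RtoC Rr)))%C) delta /\
    bigO_at Rr eta phi
      (fun z => (Gka z - (RtoC c0 - (1 - z / RtoC Rr)
                  + RtoC (c2 / 2) * (1 - z / RtoC Rr) * (1 - z / RtoC Rr)))%C)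
      (2 + delta).

Definition Hyp_Crit3 (theta kappa : nat -> R) (Rad g1R : Rbar) : Prop :=
  exists Rr eta phi : R, exists Gth Gka : C -> C,
  Crit_common theta kappa Rad g1R Rr eta phi Gth Gka /\
  exists c0 thst delta s a_s : R,
    gbR kappa Rad 0 (Finite c0) /\
    0 <= thst /\ 0 < delta /\ 1 < s < 2 /\ 0 < a_s /\
    bigO_at Rr eta phi
      (fun z => (Gth z - (- RtoC thst * Clog (1 - z / RtoC Rr)))%C) delta /\
    bigO_at Rr eta phi
      (fun z => (Gka z - (RtoC c0 - (1 - z / RtoC Rr)
                  + RtoC a_s * Cpow (1 - z / RtoC Rr) s))%C)
      (s + delta).

(* r_* : if g^{1}(R) >= 1, the r in (0,R] with g^{1}(r) = 1 (where g^{1}(R)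
   is the left limit); if g^{1}(R) < 1, r_* = R *)
Definition is_rstar (kappa : nat -> R) (Rad g1R : Rbar) (r : R) : Prop :=
  (Rbar_le 1 g1R ->
     0 < r /\ ((Rbar_lt r Rad /\ gbr kappa 1 r = 1) \/ (Finite r = Rad /\ g1R = Finite 1))) /\
  (Rbar_lt g1R 1 -> Finite r = Rad).

(* Main.v *)
(* Under [P_N] the counts [C_j] are independent Poisson variables of mean
   [(theta_j + N kappa_j) r^j / j] conditioned on [sum_j j C_j = N], for any
   [r > 0].  A Chernoff bound with [r] just below [r_*], together with Jensen's
   inequality, shows that [E_N C_j / N] tends to [kappa_j r_*^j / j] as soon as
   the conditioning event has a probability that is not exponentially small,
   i.e. [H_N >= exp (N (g_kappa r_* - ln r_* - o(1)))].  No singularity analysis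
   is needed for this lower bound: the coefficient [z^N] of [exp (N g_kappa)] is
   supermultiplicative in [N], so it is enough to bound one term of its expansion,
   for [kappa] truncated at a level [J] where [sum_(j<=J) kappa_j r^j = 1] has a
   solution [r] close to [r_*].  Non-arithmeticity makes the coefficients positive
   for all large [N].  The claim follows since [sum_j j C_j = N]. *)

Require Import Defs.
From HB Require Import structures.
From mathcomp Require Import ssreflect ssrbool ssrfun eqtype ssrnat seq choice
  fintype div finset fingroup perm bigop.
From Stdlib Require Import Reals Lra Lia Classical.
From Coquelicot Require Import Coquelicot.

Set Implicit Arguments.
Unset Strict Implicit.
Unset Printing Implicit Defensive.

Local Open Scope R_scope.
Delimit Scope nat_scope with N.

(** The limit argument sees [r_*] only as a threshold: partial sums of [kappa j * r ^ j] stay at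
    most 1 below it and reach 1 above it. This treats the supercritical case along with the others:
    there the series at [r_* = R] sums to less than 1, but it diverges beyond [R], so some
    truncation solves the equation as close to [R] as desired. The bounds on the partition function
    use radii [rho < r_* < r]. The lower one is written with the partial sum of
    [kappa i * rho ^ i / i] up to [N], which cancels exactly against that of the Chernoff bound at
    [rho]; the error left is [N (ln r - ln rho + eps)] plus a constant. Solving for the mean after a
    tilt by [t] divides this error by [t], while the second-order part of [e^t - 1] contributes
    O(t), so a gap [ln r - ln rho] of order [t^2] suffices. The tilts [t] and [- t] give the two
    sides of the limit. *)

HB.instance Definition _ := Monoid.isComLaw.Build R 0 Rplus
  (fun x y z => esym (Rplus_assoc x y z)) Rplus_comm Rplus_0_l.
HB.instance Definition _ := Monoid.isComLaw.Build R 1 Rmult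
  (fun x y z => esym (Rmult_assoc x y z)) Rmult_comm Rmult_1_l.
HB.instance Definition _ := Monoid.isMulLaw.Build R 0 Rmult Rmult_0_l Rmult_0_r.
HB.instance Definition _ := Monoid.isAddLaw.Build R Rmult Rplus
  Rmult_plus_distr_r Rmult_plus_distr_l.

(** * Sums over permutations *)

Section CycleSums.
Variables (T : finType) (x : nat -> R).
Implicit Types (s : {perm T}) (a b y : T) (A : {set T}).

(** Permutations of [A] are kept as permutations of [T] fixing the rest, so that the induction over
    subsets stays in one type; the condition [c \subset A] discards the fixed points outside [A]. *)
Definition cycleSum (A : {set T}) : R :=
  \big[Rplus/0]_(s : {perm T} | perm_on A s)
     \big[Rmult/1]_(c in porbits s | c \subset A) x #|c|.

(** The factor of the cycle through [a] is left out, since it would change whenever a point is taken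
    out of that cycle. *)
Definition cycleSumAt (A : {set T}) (a : T) (j : nat) : R :=
  \big[Rplus/0]_(s : {perm T} | perm_on A s && (#|porbit s a| == j))
     \big[Rmult/1]_(c in porbits s | c \subset A :\ a) x #|c|.

Lemma porbit_agree s t y :
  (forall z, z \in porbit t y -> s z = t z) -> porbit s y = porbit t y.
Proof.
move=> agree.
have E i : (s ^+ i)%g y = (t ^+ i)%g y.
  elim: i => [|i IH]; first by rewrite !expg0.
  by rewrite !expgSr !permM IH agree // mem_porbit.
apply/setP => z; apply/porbitP/porbitP => -[i ->]; exists i; by rewrite E.
Qed.

Lemma porbit_step s a y : (s y \in porbit s a) = (y \in porbit s a).
Proof. by rewrite -!eq_porbit_mem -{2}(expg1 s) porbit_perm. Qed.

Lemma porbit_fixed s a : s a = a -> porbit s a = [set a].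
Proof.
move=> sa; apply/setP => y; rewrite inE; apply/porbitP/eqP => [[i ->]|->].
  by elim: i => [|i IH]; rewrite ?expg0 ?perm1 // expgSr permM IH.
by exists 0%N; rewrite expg0 perm1.
Qed.

Lemma porbit_subset A s a : perm_on A s -> a \in A -> porbit s a \subset A.
Proof.
move=> sA aA; apply/subsetP => y /porbitP[i ->].
elim: i => [|i IH]; first by rewrite expg0 perm1.
by rewrite expgSr permM perm_closed.
Qed.

Lemma porbit_tpermM_out s a b y : s b = b -> y \notin b |: porbit s a ->
  porbit (tperm a b * s)%g y = porbit s y.
Proof.
move=> sb; rewrite !inE negb_or => /andP[yb ya].
apply: porbit_agree => z zy; rewrite permM tpermD //.
  by apply: contra ya => /eqP->; rewrite porbit_sym.
by apply: contra yb => /eqP E; move: zy; rewrite -E porbit_sym porbit_fixed // inE.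
Qed.

(** The product applies the transposition first, so it sends [a] to [b] and [b] to [s a]: the fixed
    point [b] is inserted right after [a]. *)
Lemma porbit_tpermM s a b : a != b -> s b = b ->
  porbit (tperm a b * s)%g a = b |: porbit s a.
Proof.
move=> ab sb; set t := (tperm a b * s)%g.
have ta : t a = b by rewrite permM tpermL.
have tb : t b = s a by rewrite permM tpermR.
have bt : b \in porbit t a by rewrite -{1}ta porbit_step porbit_id.
apply/eqP; rewrite eqEsubset; apply/andP; split; apply/subsetP => y.
  apply: contraLR => yn; rewrite porbit_sym porbit_tpermM_out // porbit_sym.
  by apply: contra yn => yn; rewrite inE yn orbT.
rewrite !inE => /orP[/eqP->//|/porbitP[i ->]].
elim: i => [|i IH]; first by rewrite expg0 perm1 porbit_id.
rewrite expgSr permM; set z := (s ^+ i)%g a in IH *.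
have [->|za] := eqVneq z a; first by rewrite -tb porbit_step.
have [->|zb] := eqVneq z b; first by rewrite sb.
suff -> : s z = t z by rewrite porbit_step.
by rewrite permM tpermD // eq_sym.
Qed.

Lemma perm_on_setD1 A s a :
  a \in A -> perm_on (A :\ a) s = perm_on A s && (s a == a).
Proof.
move=> aA; apply/idP/andP => [sA|[sA /eqP sa]].
  split; last by rewrite (out_perm sA) // !inE eqxx.
  by apply: subset_trans sA (subsetDl _ _).
apply/subsetP => y; rewrite !inE => ys; apply/andP; split.
  by apply: contra ys => /eqP->; rewrite sa.
by move/subsetP: sA => /(_ y); rewrite inE; apply.
Qed.

Lemma cycleSum0 : cycleSum set0 = 1.
Proof.
rewrite /cycleSum (big_pred1 1%g) => [|s].
  rewrite big1 // => c /andP[/imsetP[y _ ->]] /subsetP /(_ y (porbit_id _ _)).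
  by rewrite inE.
apply/idP/eqP => [/perm_on_id|->]; last exact: perm_on1.
by apply; rewrite cards0.
Qed.

Lemma cycleSumAt1 A a : a \in A -> cycleSumAt A a 1 = cycleSum (A :\ a).
Proof.
move=> aA; apply: eq_bigl => s; rewrite perm_on_setD1 //; congr (_ && _).
apply/cards1P/eqP => [[y E]|sa]; last by exists a; exact: porbit_fixed.
have := porbit_id s a; rewrite E inE => /eqP Ea.
have : s a \in porbit s a by rewrite porbit_step porbit_id.
by rewrite E inE -Ea => /eqP.
Qed.

(* Multiplying by [tperm a b], where [b = s a], takes [b] out of the cycle of [a]. *)
Lemma cycleSumAtS A a j : a \in A ->
  cycleSumAt A a j.+2 = \big[Rplus/0]_(b in A :\ a) cycleSumAt (A :\ b) a j.+1.
Proof.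
move=> aA; rewrite /cycleSumAt.
rewrite (partition_big (fun s : {perm T} => s a) (mem (A :\ a))) /=; last first.
  move=> s /andP[sA /eqP Ej]; rewrite !inE perm_closed // aA andbT.
  by apply/eqP => sa; move: Ej; rewrite porbit_fixed // cards1.
apply: eq_bigr => b; rewrite !inE => /andP[ba bA].
have inj : injective (fun s : {perm T} => tperm a b * s)%g by exact: mulgI.
rewrite (reindex_inj inj) /=.
have tab : perm_on A (tperm a b).
  apply/subsetP => y; rewrite !inE permE /=.
  have [->//|_] := eqVneq y a; have [->//|_] := eqVneq y b; by rewrite eqxx.
have ontp s : perm_on A (tperm a b * s)%g = perm_on A s.
  apply/idP/idP => H; last exact: perm_onM.
  by rewrite -(mulKg (tperm a b) s) tpermV; exact: perm_onM.
apply: eq_big => [s|s].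
  rewrite permM tpermL perm_on_setD1 // ontp -!andbA; congr (_ && _).
  rewrite andbC; case: (eqVneq (s b) b) => //= sb.
  rewrite porbit_tpermM 1?eq_sym // cardsU1.
  suff -> : b \notin porbit s a by rewrite add1n eqSS eq_sym.
  by rewrite porbit_sym porbit_fixed // inE eq_sym.
rewrite permM tpermL => /andP[_ /eqP sb].
have bNa : b \notin porbit s a by rewrite porbit_sym porbit_fixed // inE eq_sym.
apply: eq_bigl => c; apply/andP/andP => -[/imsetP[y _ Ec] /subsetP cA].
  have yt : y \notin b |: porbit s a.
    rewrite -porbit_tpermM 1?eq_sym // porbit_sym -Ec.
    by apply/negP => /cA; rewrite !inE eqxx.
  have Es : c = porbit s y by rewrite Ec porbit_tpermM_out.
  split; first by rewrite Es imset_f.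
  apply/subsetP => z zc; move: (cA z zc); rewrite !inE => /andP[-> ->]; rewrite !andbT.
  apply/eqP => zb; move: zc; rewrite zb Es porbit_sym porbit_fixed // inE => /eqP yb.
  by move: yt; rewrite yb !inE eqxx.
have yt : y \notin b |: porbit s a.
  rewrite !inE negb_or; apply/andP; split.
    by apply/eqP => yb; move: (cA y); rewrite Ec porbit_id !inE yb eqxx andbF => /(_ isT).
  rewrite porbit_sym -Ec; by apply/negP => /cA; rewrite !inE eqxx.
split; first by rewrite Ec -(porbit_tpermM_out sb yt) imset_f.
by apply/subsetP => z /cA; rewrite !inE => /andP[-> /andP[_ ->]].
Qed.

Lemma cycleSum_split A a : a \in A ->
  cycleSum A = \big[Rplus/0]_(0 <= j < #|A|) (x j.+1 * cycleSumAt A a j.+1).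
Proof.
move=> aA; rewrite /cycleSum big_mkord.
have lt s : (#|porbit s a|.-1 < #|T|.+1)%N.
  by rewrite ltnS (leq_trans (leq_pred _)) // max_card.
have ltA s : perm_on A s -> (#|porbit s a|.-1 < #|A|)%N.
  move=> sA; rewrite prednK ?card_gt0; first exact/subset_leq_card/porbit_subset.
  by apply/set0Pn; exists a; exact: porbit_id.
have A0 : (0 < #|A|)%N by apply/card_gt0P; exists a.
(* The cycle length minus one, as an ordinal; by [ltA] the default of [insubd] can occur only
   outside [perm_on A]. *)
pose p s := insubd (Ordinal A0) #|porbit s a|.-1.
rewrite (partition_big p predT) //=.
apply: eq_bigr => j _; rewrite /cycleSumAt big_distrr /=.
have pj s : perm_on A s -> (p s == j) = (#|porbit s a| == j.+1).
  move=> sA; rewrite -val_eqE val_insubd ltA // -eqSS prednK //.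
  by rewrite card_gt0; apply/set0Pn; exists a; exact: porbit_id.
apply: eq_big => [s|s /andP[sA]].
  by case sA: (perm_on A s); rewrite //= pj.
rewrite pj // => /eqP <-.
rewrite (bigD1 (porbit s a)) /=; last by rewrite imset_f ?porbit_subset.
congr (_ * _); apply: eq_bigl => c.
case: (boolP (c \in porbits s)) => //= /imsetP[y _ ->].
rewrite subsetD1; congr (_ && ~~ _).
by rewrite eq_sym eq_porbit_mem.
Qed.

End CycleSums.

(* The coefficient of [z ^ n] in [exp (sum_j x_j z^j / j)], computed from the
   recursion [n w_n = sum_j x_j w_(n-j)]; [wcoefs x n] lists [w_n, ..., w_0]. *)
Fixpoint wcoefs (x : nat -> R) (n : nat) : seq R :=
  if n is m.+1 then
    (\big[Rplus/0]_(0 <= j < n) (x j.+1 * nth 0 (wcoefs x m) j) / INR n) :: wcoefs x m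
  else [:: 1].

Definition wcoef (x : nat -> R) (n : nat) : R := head 0 (wcoefs x n).

Lemma nth_wcoefs x n j : (j <= n)%N -> nth 0 (wcoefs x n) j = wcoef x (n - j).
Proof.
elim: n j => [|n IH] [|j] //= jn; by rewrite IH.
Qed.

Lemma wcoef0 x : wcoef x 0 = 1. Proof. by []. Qed.

Lemma wcoefS x n :
  INR n.+1 * wcoef x n.+1 = \big[Rplus/0]_(0 <= j < n.+1) (x j.+1 * wcoef x (n - j)).
Proof.
have -> : wcoef x n.+1 =
    \big[Rplus/0]_(0 <= j < n.+1) (x j.+1 * nth 0 (wcoefs x n) j) / INR n.+1 by [].
rewrite Rmult_comm /Rdiv Rmult_assoc Rinv_l ?Rmult_1_r; last exact: not_0_INR.
by apply: eq_big_nat => j /andP[_ jn]; rewrite nth_wcoefs.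
Qed.

(** Both sides obey the same recursion: split by the length of the cycle of one point, then empty
    that cycle one point at a time. *)
Lemma cycleSumE (T : finType) (x : nat -> R) (A : {set T}) :
  cycleSum x A = INR (#|A|)`! * wcoef x #|A|.
Proof.
move: {2}#|A| (leqnn #|A|) => n; elim: n A => [|n IH] A.
  rewrite leqn0 cards_eq0 => /eqP->.
  by rewrite cycleSum0 cards0 /= Rmult_1_l.
move=> An; case: (set_0Vmem A) => [->|[a aA]].
  by rewrite cycleSum0 cards0 /= Rmult_1_l.
have At j (B : {set T}) b : (#|B| <= #|A|)%N -> b \in B -> (j < #|B|)%N ->
    cycleSumAt x B b j.+1 = INR (#|B|.-1)`! * wcoef x (#|B|.-1 - j).
  elim: j B b => [|j IHj] B b BA bB jB.
    have E : #|B :\ b| = #|B|.-1 by rewrite (cardsD1 b B) bB.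
    rewrite cycleSumAt1 // IH ?E ?subn0 //.
    by rewrite -ltnS prednK ?(leq_trans BA) // (leq_ltn_trans _ jB).
  (* There are [#|B| - 1] equal terms, which turn the factorial of [#|B| - 2] into that of
     [#|B| - 1]; the factorial thus does not depend on the length. *)
  rewrite cycleSumAtS // (eq_bigr (fun=> INR (#|B|.-2)`! * wcoef x (#|B|.-2 - j))).
    have E : #|B :\ b| = #|B|.-1 by rewrite (cardsD1 b B) bB.
    rewrite big_const E.
    case: #|B| jB => [|[|m]] //= _.
    rewrite subSS factS -!multE mult_INR.
    move: (_ `!) (wcoef _ _) => u v.
    rewrite (_ : iter _ _ _ = INR m * (INR u * v)); first by rewrite S_INR; ring.
    elim: m => [|k IHk]; first by rewrite Rmult_0_l.
    by rewrite iterS IHk S_INR; ring.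
  move=> c; rewrite !inE => /andP[cb cB].
  have E : #|B :\ c| = #|B|.-1 by rewrite (cardsD1 c B) cB.
  rewrite IHj ?E //; first by rewrite (leq_trans _ BA) // leq_pred.
    by rewrite !inE eq_sym cb.
  by case: #|B| jB.
rewrite (cycleSum_split _ aA).
have [m Em] : exists m, #|A| = m.+1 by exists #|A|.-1; rewrite (cardsD1 a A) aA.
rewrite Em factS -multE mult_INR (Rmult_comm (INR m.+1)) Rmult_assoc wcoefS big_distrr /=.
apply: eq_big_nat => j /andP[_ jm]; rewrite At // Em //=; ring.
Qed.

(** * Bounds on the coefficients *)

Lemma bigR_le (I : eqType) (l : seq I) (F G : I -> R) :
  (forall i, i \in l -> F i <= G i) ->
  \big[Rplus/0]_(i <- l) F i <= \big[Rplus/0]_(i <- l) G i.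
Proof.
move=> FG; rewrite big_seq [X in _ <= X]big_seq.
by elim/big_ind2: _ => //; [exact: Rle_refl | move=> *; exact: Rplus_le_compat].
Qed.

Lemma bigR_ge0 (I : eqType) (l : seq I) (F : I -> R) :
  (forall i, i \in l -> 0 <= F i) -> 0 <= \big[Rplus/0]_(i <- l) F i.
Proof.
move=> F0; rewrite big_seq.
by elim/big_ind: _ => //; [exact: Rle_refl | move=> *; exact: Rplus_le_le_0_compat].
Qed.

Lemma bigR_nat_le m n (F G : nat -> R) :
  (forall i, (m <= i < n)%N -> F i <= G i) ->
  \big[Rplus/0]_(m <= i < n) F i <= \big[Rplus/0]_(m <= i < n) G i.
Proof. by move=> FG; apply: bigR_le => i; rewrite mem_index_iota; exact: FG. Qed.

Lemma bigR_nat_ge0 m n (F : nat -> R) :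
  (forall i, (m <= i < n)%N -> 0 <= F i) -> 0 <= \big[Rplus/0]_(m <= i < n) F i.
Proof. by move=> F0; apply: bigR_ge0 => i; rewrite mem_index_iota; exact: F0. Qed.

Lemma bigR_nat_widen m n p (F : nat -> R) :
  (m <= n <= p)%N -> (forall i, (n <= i < p)%N -> 0 <= F i) ->
  \big[Rplus/0]_(m <= i < n) F i <= \big[Rplus/0]_(m <= i < p) F i.
Proof.
move=> /andP[mn np] F0; rewrite (big_cat_nat mn np) /=.
have := bigR_nat_ge0 F0; lra.
Qed.

Lemma wcoef_rec x n :
  INR n * wcoef x n = \big[Rplus/0]_(0 <= j < n) (x j.+1 * wcoef x (n - j.+1)).
Proof.
case: n => [|n]; first by rewrite big_geq // Rmult_0_l.
by rewrite wcoefS; apply: eq_big_nat => j _; rewrite subSS.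
Qed.

Lemma wcoef_ge0 x n : (forall j, (0 < j)%N -> 0 <= x j) -> 0 <= wcoef x n.
Proof.
move=> x0; elim/ltn_ind: n => -[|n] IH; first by rewrite wcoef0; lra.
apply: (Rmult_le_reg_l (INR n.+1)); first exact: lt_0_INR (ltP _).
rewrite Rmult_0_r wcoef_rec; apply: bigR_nat_ge0 => j jn.
by apply: Rmult_le_pos; [exact: x0 | apply: IH; rewrite subSS ltnS leq_subr].
Qed.

(* Applied with [m = 0] or [n = 0], this is also the monotonicity of [wcoef]. *)
Lemma wcoef_supermul x y z m n :
  (forall j, (0 < j)%N -> 0 <= x j) -> (forall j, (0 < j)%N -> 0 <= y j) ->
  (forall j, (0 < j)%N -> x j + y j <= z j) ->
  wcoef x m * wcoef y n <= wcoef z (m + n).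
Proof.
move=> x0 y0 xyz.
have z0 j : (0 < j)%N -> 0 <= z j.
  by move=> j0; move: (x0 j j0) (y0 j j0) (xyz j j0); lra.
move: {2}(m + n)%N (leqnn (m + n)) => p; elim: p m n => [|p IH] m n.
  by rewrite leqn0 addn_eq0 => /andP[/eqP-> /eqP->]; rewrite !wcoef0; lra.
rewrite leq_eqVlt => /orP[/eqP Emn|]; last by rewrite ltnS; exact: IH.
apply: (Rmult_le_reg_l (INR (m + n))); first by rewrite Emn; exact: lt_0_INR (ltP _).
rewrite wcoef_rec.
apply: (Rle_trans _ (\big[Rplus/0]_(0 <= j < m + n) (x j.+1 * wcoef z (m + n - j.+1)) +
   \big[Rplus/0]_(0 <= j < m + n) (y j.+1 * wcoef z (m + n - j.+1)))); last first.
  rewrite -big_split /=; apply: bigR_nat_le => j _; rewrite -Rmult_plus_distr_r.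
  by apply: Rmult_le_compat_r; [exact: wcoef_ge0 | exact: xyz].
(* In [m w_m w_n] the factor [wcoef x m] is expanded by its recursion, in [n w_m w_n] the factor
   [wcoef y n]; the induction hypothesis bounds each product. *)
rewrite plus_INR !Rmult_plus_distr_r; apply: Rplus_le_compat.
  rewrite -Rmult_assoc wcoef_rec big_distrl /=.
  apply: (Rle_trans _ (\big[Rplus/0]_(0 <= j < m) (x j.+1 * wcoef z (m + n - j.+1)))).
    apply: bigR_nat_le => j /andP[_ jm]; rewrite Rmult_assoc.
    apply: Rmult_le_compat_l; first exact: x0.
    rewrite -addnBAC //; apply: IH.
    by rewrite addnBAC // leq_subLR Emn addSn ltnS leq_addl.
  apply: bigR_nat_widen; first exact: leq_addr.
  by move=> j _; apply: Rmult_le_pos; [exact: x0 | exact: wcoef_ge0].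
rewrite (Rmult_comm (wcoef x m)) -Rmult_assoc wcoef_rec big_distrl /=.
apply: (Rle_trans _ (\big[Rplus/0]_(0 <= j < n) (y j.+1 * wcoef z (m + n - j.+1)))).
  apply: bigR_nat_le => j /andP[_ jn]; rewrite Rmult_assoc.
  apply: Rmult_le_compat_l; first exact: y0.
  rewrite (Rmult_comm _ (wcoef x m)) -addnBA //; apply: IH.
  by rewrite addnBA // leq_subLR Emn addSn ltnS leq_addl.
apply: bigR_nat_widen; first exact: leq_addl.
by move=> j _; apply: Rmult_le_pos; [exact: y0 | exact: wcoef_ge0].
Qed.

Lemma wcoef_le x y n :
  (forall j, (0 < j)%N -> 0 <= x j <= y j) -> wcoef x n <= wcoef y n.
Proof.
move=> xy.
have := @wcoef_supermul x (fun=> 0) y n 0; rewrite addn0 wcoef0 Rmult_1_r; apply.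
- by move=> j /xy; lra.
- by move=> *; lra.
- by move=> j /xy; lra.
Qed.

(** This is the contribution of [c] cycles of length [j]: keeping only the term of index [j] in the
    recursion gains a factor [x_j / ((c + 1) j)] at each step. *)
Lemma wcoef_ge_pow x j c : (forall j, (0 < j)%N -> 0 <= x j) -> (0 < j)%N ->
  (x j / INR j) ^ c / INR c`! <= wcoef x (c * j).
Proof.
move=> x0 j0; elim: c => [|c IH]; first by rewrite mul0n wcoef0 /=; lra.
have Rj : 0 < INR j by exact: lt_0_INR (ltP _).
have Rc : 0 < INR c.+1 by exact: lt_0_INR (ltP _).
have Rf : 0 < INR c`! by apply/lt_0_INR/ltP/fact_gt0.
have step : x j * wcoef x (c * j) <= INR (c.+1 * j) * wcoef x (c.+1 * j).
  rewrite wcoef_rec.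
  apply: (Rle_trans _ (\big[Rplus/0]_(j.-1 <= i < j) (x i.+1 * wcoef x (c.+1 * j - i.+1)))).
    by case: j j0 {IH Rj} => // j _; rewrite /= big_nat1 mulSn addKn; lra.
  rewrite (big_cat_nat (leq0n j.-1)) /=; last first.
    by rewrite (leq_trans (leq_pred _)) // leq_pmull.
  rewrite Rplus_comm -[X in X <= _]Rplus_0_r; apply: Rplus_le_compat.
    apply: bigR_nat_widen; first by rewrite leq_pred leq_pmull.
    by move=> i _; apply: Rmult_le_pos; [exact: x0 | exact: wcoef_ge0].
  by apply: bigR_nat_ge0 => i _; apply: Rmult_le_pos; [exact: x0 | exact: wcoef_ge0].
move: step; rewrite mult_INR => step.
apply: (Rmult_le_reg_l (INR c.+1 * INR j)); first exact: Rmult_lt_0_compat.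
apply: Rle_trans step.
rewrite factS -multE mult_INR.
have -> : INR c.+1 * INR j * ((x j / INR j) ^ c.+1 / (INR c.+1 * INR c`!)) =
   x j * ((x j / INR j) ^ c / INR c`!).
  by rewrite [_ ^ c.+1]/=; field; lra.
by apply: Rmult_le_compat_l => //; exact: x0.
Qed.

Lemma wcoef_ge_prod x (c : nat -> nat) J : (forall j, (0 < j)%N -> 0 <= x j) ->
  \big[Rmult/1]_(1 <= j < J.+1) ((x j / INR j) ^ c j / INR (c j)`!) <=
  wcoef x (\sum_(1 <= j < J.+1) c j * j).
Proof.
elim: J x => [|J IH] x x0; first by rewrite !big_geq // wcoef0; lra.
rewrite !(big_nat_recr J.+1) //=.
(* Lengths up to [J] go to [y], longer ones to [z]; supermultiplicativity then separates the last
   factor of the product. *)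
pose y j := if (j <= J)%N then x j else 0; pose z j := if (j <= J)%N then 0 else x j.
have y0 j : (0 < j)%N -> 0 <= y j by rewrite /y; case: ifP => // _ /x0; lra.
have z0 j : (0 < j)%N -> 0 <= z j by rewrite /z; case: ifP => // _ /x0; lra.
have := @wcoef_supermul y z x (\sum_(1 <= j < J.+1) c j * j) (c J.+1 * J.+1) y0 z0.
move=> H; apply: Rle_trans (H _); last first.
  by move=> j _; rewrite /y /z; case: ifP; lra.
have term_ge0 j c' : (0 < j)%N -> 0 <= (x j / INR j) ^ c' / INR c'`!.
  move=> j0; apply: Rle_mult_inv_pos; last by apply/lt_0_INR/ltP/fact_gt0.
  by apply/pow_le/Rle_mult_inv_pos; [exact: x0 | exact: lt_0_INR (ltP _)].
apply: Rmult_le_compat.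
- rewrite big_nat; elim/big_ind: _ => [||j /andP[/term_ge0 //]]; first lra.
  exact: Rmult_le_pos.
- exact: term_ge0.
- apply: Rle_trans (IH y y0); apply: Req_le; apply: eq_big_nat => j /andP[_ jJ].
  by rewrite /y -ltnS jJ.
- apply: Rle_trans (wcoef_ge_pow _ z0 _) => //; rewrite /z ltnn; exact: Rle_refl.
Qed.

Lemma is_derive_bigR (I : eqType) (l : seq I) (F dF : I -> R -> R) (t : R) :
  (forall i, i \in l -> is_derive (F i) t (dF i t)) ->
  is_derive (fun u => \big[Rplus/0]_(i <- l) F i u) t (\big[Rplus/0]_(i <- l) dF i t).
Proof.
elim: l => [|i l IH] Hd.
  rewrite big_nil; apply: (is_derive_ext (fun=> 0)) => [u|]; first by rewrite big_nil.
  exact: (@is_derive_const R_AbsRing R_NormedModule).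
rewrite big_cons; apply: (is_derive_ext (fun u => F i u + \big[Rplus/0]_(i <- l) F i u)).
  by move=> u; rewrite big_cons.
apply: is_derive_plus; first by apply: Hd; rewrite inE eqxx.
by apply: IH => k kl; apply: Hd; rewrite inE kl orbT.
Qed.

(* Gronwall: the truncation [Y] of [sum_k w_k t^k] satisfies [Y' <= S' Y]. *)
Lemma wcoef_upper x n r : (forall j, (0 < j)%N -> 0 <= x j) -> 0 <= r ->
  wcoef x n * r ^ n <= exp (\big[Rplus/0]_(1 <= j < n.+1) (x j * r ^ j / INR j)).
Proof.
move=> x0 r0.
pose Y t := \big[Rplus/0]_(0 <= k < n.+1) (wcoef x k * t ^ k).
pose Y' t := \big[Rplus/0]_(0 <= k < n.+1) (INR k * wcoef x k * t ^ k.-1).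
pose S t := \big[Rplus/0]_(1 <= j < n.+1) (x j * t ^ j / INR j).
pose S' t := \big[Rplus/0]_(1 <= j < n.+1) (x j * t ^ j.-1).
have dY t : is_derive Y t (Y' t).
  apply: (@is_derive_bigR _ _ (fun k u => wcoef x k * u ^ k)
    (fun k u => INR k * wcoef x k * u ^ k.-1)) => k _.
  by auto_derive; [|ring].
have dS t : is_derive S t (S' t).
  apply: (@is_derive_bigR _ _ (fun j u => x j * u ^ j / INR j)
    (fun j u => x j * u ^ j.-1)) => k; rewrite mem_index_iota => /andP[k0 _].
  by auto_derive; [|field; apply: not_0_INR; case: k k0].
have Y0 t m : 0 <= t -> 0 <= \big[Rplus/0]_(0 <= k < m) (wcoef x k * t ^ k).
  move=> t0; apply: bigR_nat_ge0 => k _.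
  by apply: Rmult_le_pos; [exact: wcoef_ge0 | exact: pow_le].
have ineq t : 0 <= t -> Y' t <= S' t * Y t.
  move=> t0.
  (* The recursion is inserted in each [k w_k] and [t ^ (k - 1)] is split; after exchanging the
     sums, the inner sum over [k] is [Y] with its last [j + 1] terms removed. *)
  have -> : Y' t = \big[Rplus/0]_(0 <= k < n.+1) \big[Rplus/0]_(0 <= j < n | (j < k)%N)
       (x j.+1 * t ^ j * (wcoef x (k - j.+1) * t ^ (k - j.+1))).
    apply: eq_big_nat => k /andP[_ kn]; rewrite wcoef_rec big_distrl /=.
    rewrite (big_nat_widen 0 k n) //; apply: eq_bigr => j jk.
    rewrite (_ : k.-1 = (j + (k - j.+1))%N) ?pow_add; first by ring.
    by rewrite -subn1 -{1}(subnKC jk) addSn subn1.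
  rewrite (exchange_big_dep xpredT) //= /S' big_add1 /= big_distrl /=.
  apply: bigR_nat_le => j /andP[_ jn].
  rewrite -big_distrr /=; apply: Rmult_le_compat_l.
    by apply: Rmult_le_pos; [exact: x0 | exact: pow_le].
  have -> : \big[Rplus/0]_(0 <= k < n.+1 | (j < k)%N) (wcoef x (k - j.+1) * t ^ (k - j.+1)) =
      \big[Rplus/0]_(0 <= k < n - j) (wcoef x k * t ^ k).
    transitivity (\big[Rplus/0]_(j.+1 <= k < n.+1) (wcoef x (k - j.+1) * t ^ (k - j.+1))).
      by rewrite (big_nat_widenl j.+1 0).
    rewrite -[j.+1 in LHS]add0n big_addn subSS.
    by apply: eq_bigr => k _; rewrite addnK.
  apply: bigR_nat_widen; first by rewrite leq0n ltnW // ltnS leq_subr.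
  by move=> k _; apply: Rmult_le_pos; [exact: wcoef_ge0 | exact: pow_le].
(* By [ineq] this function does not increase on [[0, r]], and it equals 1 at 0. *)
pose f t := Y t * exp (- S t).
have df t : is_derive f t ((Y' t - S' t * Y t) * exp (- S t)).
  apply: (is_derive_ext (fun t => Y t * exp (- S t))) => //.
  evar_last.
    apply: is_derive_mult; first exact: dY.
      apply: (is_derive_comp exp (fun t => - S t)); first exact: is_derive_exp.
      exact/is_derive_opp/dS.
    by move=> *; exact: Rmult_comm.
  rewrite /plus /mult /scal /opp /= /mult /=; ring.
have [||c [cr E]] := MVT_gen f 0 r (fun t => (Y' t - S' t * Y t) * exp (- S t)).
- by move=> t _; exact: df.
- by move=> t _; apply/continuity_pt_filterlim/ex_derive_continuous; eexists; exact: df.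
have S0 : S 0 = 0.
  rewrite /S big_nat big1 // => j /andP[j0 _].
  by rewrite pow_i; [rewrite /Rdiv; ring | exact/ltP].
have Y01 : Y 0 = 1.
  rewrite /Y big_nat_recl // big1 => [|j _]; first by rewrite wcoef0 /=; ring.
  by rewrite pow_i; [ring | exact/ltP].
have f0 : f 0 = 1 by rewrite /f S0 Y01 Ropp_0 exp_0; ring.
have fr : f r <= 1.
  move: cr; rewrite Rmin_left // Rmax_right // => -[c0 _].
  have H1 := ineq c c0; have H2 := exp_pos (- S c).
  have H3 : 0 <= (S' c * Y c - Y' c) * exp (- S c) * r.
    by apply: Rmult_le_pos => //; apply: Rmult_le_pos; lra.
  rewrite f0 in E; lra.
apply: (Rle_trans _ (Y r)).
  rewrite /Y (big_nat_recr n) //= -[X in X <= _]Rplus_0_l.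
  by apply: Rplus_le_compat_r; exact: Y0.
apply: (Rmult_le_reg_r (exp (- S r))); first exact: exp_pos.
by rewrite -exp_plus Rplus_opp_r exp_0.
Qed.

(** * Lower bound for the partition function *)

Lemma exp_le x y : x <= y -> exp x <= exp y.
Proof.
by case=> [/exp_increasing /Rlt_le //|->]; exact: Rle_refl.
Qed.

Lemma exp_mul_INR n t : exp (INR n * t) = exp t ^ n.
Proof.
elim: n => [|n IH]; first by rewrite Rmult_0_l exp_0.
by rewrite S_INR Rmult_plus_distr_r Rmult_1_l exp_plus IH /= Rmult_comm.
Qed.

Lemma exp_bigR (I : Type) (l : seq I) (F : I -> R) :
  exp (\big[Rplus/0]_(i <- l) F i) = \big[Rmult/1]_(i <- l) exp (F i).
Proof. by apply: (big_morph exp exp_plus exp_0). Qed.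

Lemma bigRmul_nat_le m n (F G : nat -> R) :
  (forall i, (m <= i < n)%N -> 0 <= F i <= G i) ->
  \big[Rmult/1]_(m <= i < n) F i <= \big[Rmult/1]_(m <= i < n) G i.
Proof.
move=> FG.
suff [] : 0 <= \big[Rmult/1]_(m <= i < n) F i <= \big[Rmult/1]_(m <= i < n) G i by [].
rewrite !big_nat; elim/big_ind2: _ => //; first lra.
move=> x1 x2 y1 y2 [? ?] [? ?]; split; first exact: Rmult_le_pos.
exact: Rmult_le_compat.
Qed.

(** Descent on a difference [d] of two members: a member [i] not divisible by [d] produces two
    members at distance [i %% d], until [d = 1]. *)
Lemma semigroup_eventually (S : nat -> Prop) :
  S 0%N -> (forall m n, S m -> S n -> S (m + n)%N) ->
  (exists2 j, (0 < j)%N & S j) ->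
  (forall d, (1 < d)%N -> exists2 j, S j & ~~ (d %| j)) ->
  exists n0, forall n, (n0 <= n)%N -> S n.
Proof.
move=> S0 SD [j j0 Sj] nonar.
have SM k m : S m -> S (k * m)%N.
  by move=> Sm; elim: k => [|k IH]; rewrite ?mul0n // mulSn; exact: SD.
suff H d : (0 < d)%N -> (exists2 n, S n & S (n + d)%N) ->
    exists n0, forall n, (n0 <= n)%N -> S n.
  by apply: (H j) => //; exists 0%N.
elim/ltn_ind: d => d IH d0 [m Sm Smd].
case: (ltnP 1 d) => d1.
  have [i Si di] := nonar d d1.
  apply: (IH (i %% d)%N); [exact: ltn_pmod | by rewrite lt0n |].
  exists (i %/ d * (m + d))%N; first exact: SM.
  rewrite mulnDr -addnA -divn_eq; apply: SD => //; exact: SM.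
have {IH d0 d1} E : d = 1%N by apply/eqP; rewrite eqn_leq d1.
(* Now [m] and [m + 1] are members. For [n >= m^2] and [m > 0], the quotient [q] of [n] by [m] is at
   least the remainder [t], and [n = (q - t) m + t (m + 1)]. *)
exists (m * m)%N => n mn.
have [m0|m0] := posnP m.
  rewrite m0 E in Smd; rewrite -(muln1 n); exact: SM.
rewrite (divn_eq n m).
have lt : (n %% m <= n %/ m)%N.
  by rewrite (leq_trans (ltnW (ltn_pmod _ m0))) // leq_divRL.
have -> : (n %/ m * m + n %% m = (n %/ m - n %% m) * m + n %% m * (m + d))%N.
  by rewrite E mulnDr muln1 addnA -mulnDl subnK.
by apply: SD; exact: SM.
Qed.

(** Stirling's upper bound up to a polynomial factor. The induction runs on the sharper factor [c];
    the factor [c + 1] also covers [c = 0], where [c ^ c] is 1. *)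
Lemma fact_exp_le c : INR c`! * exp (INR c) <= exp 1 * (INR c + 1) * INR c ^ c.
Proof.
case: c => [|c]; first by rewrite /= exp_0; have := exp_ineq1_le 1; lra.
apply: (Rle_trans _ (exp 1 * INR c.+1 * INR c.+1 ^ c.+1)); last first.
  apply: Rmult_le_compat_r; first exact/pow_le/pos_INR.
  apply: Rmult_le_compat_l; [exact/Rlt_le/exp_pos | lra].
elim: c => [|c IH]; first by rewrite /=; lra.
set n := c.+1 in IH *.
have n0 : 0 < INR n by exact: lt_0_INR (ltP _).
(* Equivalent to [e <= (1 + 1/n) ^ (n + 1)]; it follows from [1 - u <= e^(-u)] at
   [u = 1/(n + 1)]. *)
have e1 : exp 1 * INR n ^ n.+1 <= INR n.+1 ^ n.+1.
  have -> : exp 1 = exp (/ INR n.+1) ^ n.+1.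
    by rewrite -exp_mul_INR Rinv_r //; exact: not_0_INR.
  rewrite -Rpow_mult_distr; apply: pow_incr; split.
    by apply: Rmult_le_pos; [exact/Rlt_le/exp_pos | lra].
  have := exp_ineq1_le (- / INR n.+1); rewrite exp_Ropp.
  have p := exp_pos (/ INR n.+1); have q : 0 < INR n.+1 by exact: lt_0_INR (ltP _).
  move=> H; apply: (Rmult_le_reg_l (/ exp (/ INR n.+1) * / INR n.+1)).
    by apply: Rmult_lt_0_compat; exact: Rinv_0_lt_compat.
  have -> : / exp (/ INR n.+1) * / INR n.+1 * (exp (/ INR n.+1) * INR n) = 1 + - / INR n.+1.
    rewrite (S_INR n); field; rewrite -(S_INR n); lra.
  by apply: Rle_trans H _; apply: Req_le; field; lra.
rewrite factS -multE mult_INR [in exp _](S_INR n) exp_plus.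
have -> : INR n.+1 * INR n`! * (exp (INR n) * exp 1) =
   (INR n.+1 * exp 1) * (INR n`! * exp (INR n)) by ring.
apply: (Rle_trans _ (INR n.+1 * exp 1 * (exp 1 * INR n * INR n ^ n))).
  apply: Rmult_le_compat_l => //.
  by apply: Rmult_le_pos; [exact: pos_INR | exact/Rlt_le/exp_pos].
have -> : INR n.+1 * exp 1 * (exp 1 * INR n * INR n ^ n) =
  exp 1 * INR n.+1 * (exp 1 * INR n ^ n.+1) by rewrite /=; ring.
apply: Rmult_le_compat_l => //.
by apply: Rmult_le_pos; [exact/Rlt_le/exp_pos | exact: pos_INR].
Qed.

Lemma pow_div_fact_ge c : exp (INR c - 1 - ln (INR c + 1)) <= INR c ^ c / INR c`!.
Proof.
have c1 : 0 < INR c + 1 by have := pos_INR c; lra.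
have f0 : 0 < INR c`! by apply/lt_0_INR/ltP/fact_gt0.
have e1 := exp_pos 1.
apply: (Rmult_le_reg_l (INR c`! * exp 1 * (INR c + 1))).
  by apply: Rmult_lt_0_compat => //; exact: Rmult_lt_0_compat.
have -> : INR c`! * exp 1 * (INR c + 1) * (INR c ^ c / INR c`!) =
   exp 1 * (INR c + 1) * INR c ^ c by field; lra.
apply: Rle_trans (fact_exp_le c); apply: Req_le.
rewrite /Rminus !exp_plus !exp_Ropp exp_ln //; field; lra.
Qed.

Definition floor (y : R) : nat := Z.to_nat (Int_part y).

Lemma floor_spec y : 0 <= y -> INR (floor y) <= y < INR (floor y) + 1.
Proof.
move=> y0; have [H1 H2] := base_Int_part y.
have p : (0 <= Int_part y)%Z.
  have : (-1 < Int_part y)%Z by apply: lt_IZR; lra.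
  by move=> ?; lia.
rewrite /floor INR_IZR_INZ Znat.Z2Nat.id //; lra.
Qed.

Lemma exp_neg_double_le x : 0 <= x <= 1 / 2 -> exp (- (2 * x)) <= 1 - x.
Proof.
move=> x0; rewrite exp_Ropp; have H := exp_ineq1_le (2 * x).
apply: (Rmult_le_reg_l (exp (2 * x))); first exact: exp_pos.
rewrite Rinv_r; last by have := exp_pos (2 * x); lra.
apply: (Rle_trans _ ((1 + 2 * x) * (1 - x))); first nra.
by apply: Rmult_le_compat_r; lra.
Qed.

(** The tangent of [ln] at [1/b]. A small slope [b] turns the logarithmic loss in [pow_div_fact_ge]
    into a constant plus a small multiple of [N]. *)
Lemma ln_le_linear b x : 0 < b -> 0 < x -> ln x <= b * x - 1 - ln b.
Proof.
move=> b0 x0; have bx : 0 < b * x by exact: Rmult_lt_0_compat.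
have := exp_ineq1_le (ln (b * x)); rewrite exp_ln // ln_mult //; lra.
Qed.

Section LowerBound.
Variable kappa : nat -> R.
Hypothesis kappa0 : forall j, (0 < j)%N -> 0 <= kappa j.

(** The coefficient of [z^N] in [exp (N g_kappa)], that is, [H_N] for [theta = 0]. *)
Definition diagCoef (N : nat) : R := wcoef (fun j => INR N * kappa j) N.

Lemma diagCoef_supermul M N : diagCoef M * diagCoef N <= diagCoef (M + N).
Proof.
apply: wcoef_supermul => j j0; try by apply: Rmult_le_pos; [exact: pos_INR | exact: kappa0].
by rewrite plus_INR; lra.
Qed.

(** A single cycle of length [i] gives [kappa i <= diagCoef i], so the indices of positive
    coefficients form a semigroup containing the support of [kappa]. *)
Lemma diagCoef_gt0 : non_arithmetic kappa -> (exists j : nat, leq 2 j /\ 0 < kappa j) ->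
  exists N0, forall N, (N0 <= N)%N -> 0 < diagCoef N.
Proof.
move=> nonar [j [j2 kj]].
have pos i : (0 < i)%N -> 0 < kappa i -> 0 < diagCoef i.
  move=> i0 ki; have Ri : 0 < INR i by exact: lt_0_INR (ltP _).
  have := @wcoef_ge_pow (fun j => INR i * kappa j) i 1.
  rewrite mul1n /= => H; apply: (Rlt_le_trans _ _ _ _ (H _ i0)).
    have -> : INR i * kappa i / INR i * 1 / 1 = kappa i by field; lra.
    exact: ki.
  by move=> l l0; apply: Rmult_le_pos; [exact: pos_INR | exact: kappa0].
apply: semigroup_eventually.
- rewrite /diagCoef wcoef0; lra.
- by move=> m n m0 n0; apply: Rlt_le_trans (diagCoef_supermul m n); exact: Rmult_lt_0_compat.
- by exists j; [exact: ltnW | apply: pos => //; exact: ltnW].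
move=> d d1; apply: NNPP => no; apply: nonar; exists d; split => // i i0 ki.
apply/negPn/negP => di; apply: no; exists i => //; apply: pos => //.
by have := kappa0 i0; lra.
Qed.

(* The product bound is evaluated at the typical cycle counts [c j ~ N kappa_j r^j / j]. *)
Lemma diagCoef_exists_lower J r eps : 0 < r -> 0 < eps ->
  \big[Rplus/0]_(1 <= j < J.+1) (kappa j * r ^ j) = 1 ->
  exists2 M, (0 < M)%N & exp (INR M *
    (\big[Rplus/0]_(1 <= j < J.+1) (kappa j * r ^ j / INR j) - ln r - eps)) <= diagCoef M.
Proof.
move=> r0 eps0 sum1; set P := \big[Rplus/0]_(1 <= j < J.+1) _.
pose D := \big[Rplus/0]_(1 <= j < J.+1) INR j.
have D0 : 0 <= D by apply: bigR_nat_ge0 => j _; exact: pos_INR.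
have kr0 j : (0 < j)%N -> 0 <= kappa j * r ^ j.
  by move=> j0; apply: Rmult_le_pos; [exact: kappa0 | apply: pow_le; lra].
have J0 := pos_INR J.
(* The slope [b] spreads [eps / 4] over the [J] lengths. [K0] collects the constant losses of one
   length: 1 from [floor], 1 from [pow_div_fact_ge], [2 D] from the ratio [M / N], and the constants
   of the tangent with slope [b]. *)
pose b := eps / (4 * (INR J + 1)).
have b0 : 0 < b by apply: Rdiv_lt_0_compat; lra.
pose K0 := Rabs (2 + 2 * D + b - 1 - ln b).
have [N HN] : exists N : nat, 1 + 2 * D + 4 * INR J * K0 / eps < INR N.
  have [N HN] := INR_archimed 1 (1 + 2 * D + 4 * INR J * K0 / eps) Rlt_0_1.
  by exists N; lra.
have K00 : 0 <= K0 by exact: Rabs_pos.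
have HJK : 0 <= 4 * INR J * K0 / eps.
  by apply: Rle_mult_inv_pos => //; apply: Rmult_le_pos => //; lra.
have N0 : 0 < INR N by lra.
pose y j := INR N * (kappa j * r ^ j) / INR j.
have INRj j : (0 < j)%N -> 1 <= INR j by move=> j0; apply: (le_INR 1); exact/leP.
have y0 j : (0 < j)%N -> 0 <= y j.
  move=> j0; apply: Rle_mult_inv_pos; last by have := INRj j j0; lra.
  by apply: Rmult_le_pos; [lra | exact: kr0].
pose c j := floor (y j).
have cy j : (0 < j)%N -> INR (c j) <= y j < INR (c j) + 1 by move=> /y0/floor_spec.
have yj j : (0 < j)%N -> y j * INR j = INR N * (kappa j * r ^ j).
  by move=> j0; rewrite /y; field; have := INRj j j0; lra.
(* Rounding down makes the total length [M] smaller than [N], by at most [D]; the coefficient is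
   taken at [M], so its rates are [M kappa_j] and not [N kappa_j]. *)
pose M := (\sum_(1 <= j < J.+1) c j * j)%N.
have EM : INR M = \big[Rplus/0]_(1 <= j < J.+1) (INR (c j) * INR j).
  rewrite /M (big_morph INR plus_INR (erefl _)).
  by apply: eq_bigr => j _; rewrite -mult_INR.
have EN : INR N = \big[Rplus/0]_(1 <= j < J.+1) (y j * INR j).
  rewrite -[LHS]Rmult_1_r -sum1 big_distrr /=; apply: eq_big_nat => j /andP[j0 _].
  by rewrite yj.
have MN : INR M <= INR N.
  rewrite EM EN; apply: bigR_nat_le => j /andP[j0 _].
  by apply: Rmult_le_compat_r; [exact: pos_INR | have := cy j j0; lra].
have NM : INR N - D <= INR M.
  suff : INR N <= INR M + D by lra.
  rewrite EM EN /D -big_split /=; apply: bigR_nat_le => j /andP[j0 _].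
  have := cy j j0; have := INRj j j0; nra.
have M0 : 0 < INR M by lra.
exists M; first by apply/ltP/INR_lt; rewrite /=.
have kle1 j : (0 < j < J.+1)%N -> kappa j * r ^ j <= 1.
  move=> /andP[j0 jJ]; rewrite -sum1 (big_cat_nat j0 (ltnW jJ)) /= (big_ltn jJ).
  have H1 : 0 <= \big[Rplus/0]_(1 <= i < j) (kappa i * r ^ i).
    by apply: bigR_nat_ge0 => i /andP[i0 _]; exact: kr0.
  have H2 : 0 <= \big[Rplus/0]_(j.+1 <= i < J.+1) (kappa i * r ^ i).
    by apply: bigR_nat_ge0 => i /andP[i0 _]; apply: kr0; exact: leq_trans i0.
  lra.
have cN j : (0 < j < J.+1)%N -> INR (c j) <= INR N.
  move=> /[dup] jJ /andP[j0 _]; have [c1 _] := cy j j0; apply: Rle_trans c1 _.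
  have h1 : y j * 1 <= y j * INR j.
    by apply: Rmult_le_compat_l; [exact: y0 | exact: INRj].
  have h2 : INR N * (kappa j * r ^ j) <= INR N * 1.
    by apply: Rmult_le_compat_l; [lra | exact: kle1].
  by rewrite yj // in h1; lra.
have MNexp : exp (- (2 * (D / INR N))) <= INR M / INR N.
  apply: Rle_trans (exp_neg_double_le _) _.
    split; first exact: Rle_mult_inv_pos.
    by apply: (Rmult_le_reg_r (INR N)) => //; rewrite /Rdiv Rmult_assoc Rinv_l; lra.
  apply: (Rmult_le_reg_r (INR N)) => //.
  have -> : INR M / INR N * INR N = INR M by field; lra.
  have -> : (1 - D / INR N) * INR N = INR N - D by field; lra.
  exact: NM.
(* With its power of [r], the rate [M kappa_j / j] becomes [(M / N) y_j]; since [c_j <= N], the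
   factor [(M / N) ^ c_j] costs at most [exp (- 2 D)]. *)
have term j : (1 <= j < J.+1)%N ->
    exp (y j - (K0 + b * INR N)) <=
    (INR M * kappa j / INR j) ^ c j / INR (c j)`! * r ^ (c j * j).
  move=> /[dup] jJ /andP[j0 _]; have Rj := INRj j j0.
  have f0 : 0 < INR (c j)`! by apply/lt_0_INR/ltP/fact_gt0.
  have -> : (INR M * kappa j / INR j) ^ c j / INR (c j)`! * r ^ (c j * j) =
     (INR M / INR N * y j) ^ c j / INR (c j)`!.
    rewrite mulnC pow_mult /Rdiv Rmult_assoc (Rmult_comm (/ _)) -Rmult_assoc.
    rewrite -Rpow_mult_distr /y; congr (_ ^ _ * _); field; lra.
  apply: (Rle_trans _ ((INR M / INR N) ^ c j * (INR (c j) ^ c j / INR (c j)`!))); last first.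
    rewrite /Rdiv -Rmult_assoc -Rpow_mult_distr; apply: Rmult_le_compat_r.
      exact/Rlt_le/Rinv_0_lt_compat.
    apply: pow_incr; split.
      by apply: Rmult_le_pos; [apply: Rle_mult_inv_pos; lra | exact: pos_INR].
    apply: Rmult_le_compat_l; first by apply: Rle_mult_inv_pos; lra.
    by have := cy j j0; lra.
  apply: (Rle_trans _ (exp (- (2 * D)) * exp (INR (c j) - 1 - ln (INR (c j) + 1)))).
    rewrite -exp_plus; apply: exp_le.
    have [c1 c2] := cy j j0; have c3 := cN j jJ; have c4 := pos_INR (c j).
    have := @ln_le_linear b (INR (c j) + 1) b0.
    have : b * INR (c j) <= b * INR N by apply: Rmult_le_compat_l; lra.
    have := Rle_abs (2 + 2 * D + b - 1 - ln b); rewrite -/K0; lra.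
  apply: Rmult_le_compat; try exact/Rlt_le/exp_pos; last exact: pow_div_fact_ge.
  apply: (Rle_trans _ (exp (- (2 * (D / INR N))) ^ c j)); last first.
    by apply: pow_incr; split; [exact/Rlt_le/exp_pos | exact: MNexp].
  rewrite -exp_mul_INR; apply: exp_le.
  have : INR (c j) * (D / INR N) <= INR N * (D / INR N).
    apply: Rmult_le_compat_r; first exact: Rle_mult_inv_pos.
    exact: cN.
  have -> : INR N * (D / INR N) = D by field; lra.
  lra.
have x0 j : (0 < j)%N -> 0 <= INR M * kappa j.
  by move=> j0; apply: Rmult_le_pos; [lra | exact: kappa0].
have lower := wcoef_ge_prod c J x0; rewrite -/M -/(diagCoef M) in lower.
have P0 : 0 <= P.
  apply: bigR_nat_ge0 => j /andP[j0 _]; apply: Rle_mult_inv_pos; first exact: kr0.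
  have := INRj j j0; lra.
have rM : 0 < r ^ M by exact: pow_lt.
apply: (Rmult_le_reg_r (r ^ M)) => //.
apply: Rle_trans (Rmult_le_compat_r _ _ _ (Rlt_le _ _ rM) lower).
have rpow : r ^ M = \big[Rmult/1]_(1 <= j < J.+1) r ^ (c j * j).
  exact: (big_morph (pow r) (pow_add r) (erefl _)).
rewrite [X in _ <= _ * X]rpow -big_split /=.
apply: Rle_trans (bigRmul_nat_le (fun j jJ => conj (Rlt_le _ _ (exp_pos _)) (term j jJ))).
rewrite -exp_bigR -{2}(exp_ln _ r0) -exp_mul_INR -exp_plus; apply: exp_le.
have -> : \big[Rplus/0]_(1 <= j < J.+1) (y j - (K0 + b * INR N)) =
   INR N * P - INR J * (K0 + b * INR N).
  rewrite big_split /= -[X in _ + X]/(\big[Rplus/0]_(1 <= j < J.+1) - (K0 + b * INR N)).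
  rewrite big_const_nat subSS subn0 /P big_distrr /=; congr (_ + _).
    by apply: eq_bigr => j _; rewrite /y /Rdiv Rmult_assoc.
  elim: (J) => [|i IH]; first by rewrite /=; ring.
  by rewrite iterS IH S_INR; ring.
have : INR M * P <= INR N * P by apply: Rmult_le_compat_r.
suff : INR J * (K0 + b * INR N) <= INR M * eps by lra.
have Jb : INR J * b <= eps / 4.
  rewrite /b; apply: (Rmult_le_reg_r (4 * (INR J + 1))); first lra.
  have -> : INR J * (eps / (4 * (INR J + 1))) * (4 * (INR J + 1)) = INR J * eps by field; lra.
  nra.
have H1 : 4 * INR J * K0 <= INR N * eps.
  have : 4 * INR J * K0 / eps * eps <= INR N * eps by apply: Rmult_le_compat_r; lra.
  by rewrite /Rdiv Rmult_assoc Rinv_l; lra.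
have H2 : INR J * b * INR N <= eps / 4 * INR N by apply: Rmult_le_compat_r; lra.
nra.
Qed.

(** Fekete's argument with [N = q M + (N0 + t)], [t < M]. The shift by [N0] keeps the leftover
    factor positive; it takes finitely many values, so [eps N] absorbs it. *)
Lemma diagCoef_eventually_lower M b eps N0 : (0 < M)%N -> 0 < eps ->
  exp (INR M * b) <= diagCoef M -> (forall N, (N0 <= N)%N -> 0 < diagCoef N) ->
  exists N1, forall N, (N1 <= N)%N -> exp (INR N * (b - eps)) <= diagCoef N.
Proof.
move=> M0 eps0 HM pos.
have [a [a0 Ha]] : exists a, 0 < a /\ forall t, (t < M)%N -> a <= diagCoef (N0 + t).
  elim: (M) => [|m [a [a0 Ha]]]; first by exists 1; split => //; lra.
  exists (Rmin a (diagCoef (N0 + m))); split.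
    by apply: Rmin_glb_lt => //; apply: pos; exact: leq_addr.
  move=> t; rewrite ltnS leq_eqVlt => /orP[/eqP->|/Ha]; first exact: Rmin_r.
  exact/Rle_trans/Rmin_l.
have [N1 HN1] := INR_archimed eps (INR (N0 + M) * Rabs b - ln a) eps0.
exists (N0 + N1)%N => N NN1.
have NN0 : (N0 <= N)%N by exact: leq_trans (leq_addr _ _) NN1.
pose q := ((N - N0) %/ M)%N; pose t := ((N - N0) %% M)%N.
have tM : (t < M)%N by rewrite ltn_pmod.
have EN : N = (q * M + (N0 + t))%N by rewrite addnCA -divn_eq subnKC.
have powq : exp (INR M * b) ^ q <= diagCoef (q * M).
  elim: (q) => [|k IH]; first by rewrite mul0n /diagCoef wcoef0 /=; lra.
  rewrite mulSn /=; apply: Rle_trans (diagCoef_supermul _ _).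
  by apply: Rmult_le_compat => //; [exact/Rlt_le/exp_pos | exact/pow_le/Rlt_le/exp_pos].
rewrite [in diagCoef _]EN; apply: Rle_trans (diagCoef_supermul _ _).
apply: (Rle_trans _ (exp (INR M * b) ^ q * a)); last first.
  apply: Rmult_le_compat => //; try exact: Ha; last lra.
  exact/pow_le/Rlt_le/exp_pos.
rewrite -exp_mul_INR -(exp_ln _ a0) -exp_plus; apply: exp_le.
have E2 : INR N = INR q * INR M + INR (N0 + t) by rewrite {1}EN plus_INR mult_INR.
have tle : INR (N0 + t) <= INR (N0 + M) by apply/le_INR/leP; rewrite leq_add2l ltnW.
have H3 : INR (N0 + t) * b <= INR (N0 + M) * Rabs b.
  apply: (Rle_trans _ (INR (N0 + t) * Rabs b)).
    by apply: Rmult_le_compat_l; [exact: pos_INR | exact: Rle_abs].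
  by apply: Rmult_le_compat_r; [exact: Rabs_pos | exact: tle].
have NN : INR N1 <= INR N by apply/le_INR/leP/(leq_trans _ NN1)/leq_addl.
have : INR N1 * eps <= INR N * eps by apply: Rmult_le_compat_r; lra.
move: E2 HN1 => -> ; nra.
Qed.

Lemma diagCoef_lower J r eps : non_arithmetic kappa ->
  (exists j : nat, leq 2 j /\ 0 < kappa j) -> 0 < r -> 0 < eps ->
  \big[Rplus/0]_(1 <= j < J.+1) (kappa j * r ^ j) = 1 ->
  exists N1, forall N, (N1 <= N)%N -> exp (INR N *
    (\big[Rplus/0]_(1 <= j < J.+1) (kappa j * r ^ j / INR j) - ln r - eps)) <= diagCoef N.
Proof.
move=> nonar knz r0 eps0 sum1.
have e2 : 0 < eps / 2 by lra.
have [N0 pos] := diagCoef_gt0 nonar knz.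
have [M M0 HM] := diagCoef_exists_lower r0 e2 sum1.
have [N1 HN1] := diagCoef_eventually_lower M0 e2 HM pos.
exists N1 => N /HN1; apply: Rle_trans; apply: Req_le; congr (exp (_ * _)); lra.
Qed.

End LowerBound.

(** * Expected cycle counts *)

Lemma sumR_big (I : Type) (l : seq I) (F : I -> R) :
  sumR [seq F i | i <- l] = \big[Rplus/0]_(i <- l) F i.
Proof. by elim: l => [|i l IH]; rewrite ?big_nil // big_cons -IH. Qed.

Lemma prodR_big (I : Type) (l : seq I) (F : I -> R) :
  prodR [seq F i | i <- l] = \big[Rmult/1]_(i <- l) F i.
Proof. by elim: l => [|i l IH]; rewrite ?big_nil // big_cons -IH. Qed.

Lemma sumS_big N (f : 'S_N -> R) : sumS f = \big[Rplus/0]_(s : 'S_N) f s.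
Proof. by rewrite /sumS sumR_big big_enum. Qed.

Lemma big_pred1_seq (I : eqType) (M : Type) (idx : M) (op : Monoid.com_law idx)
    (l : seq I) (i : I) (F : I -> M) : uniq l -> i \in l ->
  \big[op/idx]_(j <- l | j == i) F j = F i.
Proof.
move=> ul il; rewrite big_mkcond (bigD1_seq i) //= eqxx big1 ?Monoid.mulm1 // => j.
by move/negbTE->.
Qed.

Lemma big_cycle_length (M : Type) (idx : M) (op : Monoid.com_law idx) N (s : 'S_N)
    (F : nat -> M) :
  \big[op/idx]_(j <- seq.iota 1 N) \big[op/idx]_(c in porbits s | #|c| == j) F j =
  \big[op/idx]_(c in porbits s) F #|c|.
Proof.
rewrite (exchange_big_dep (mem (porbits s))) /=; last by move=> j c _ /andP[].
apply: eq_bigr => c cs.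
rewrite (eq_bigl (pred1 #|c|)) => [|j]; last by rewrite cs /= eq_sym.
rewrite big_pred1_seq ?iota_uniq // mem_iota add1n ltnS.
have /imsetP[y _ ->] := cs; apply/andP; split.
  by rewrite card_gt0; apply/set0Pn; exists y; exact: porbit_id.
by rewrite -[X in (_ <= X)%N]card_ord max_card.
Qed.

Lemma prod_Ccount N (s : 'S_N) (x : nat -> R) :
  prodR [seq x j ^ Ccount j s | j <- seq.iota 1 N] =
  \big[Rmult/1]_(c in porbits s) x #|c|.
Proof.
rewrite prodR_big -[RHS]big_cycle_length; apply: eq_bigr => j _.
rewrite /Ccount big_const.
rewrite (@eq_card _ _ [pred c in porbits s | #|c| == j]) => [|c]; last by rewrite !inE.
by elim: #|_| => [|n IH] //=; rewrite IH.
Qed.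

Lemma sum_Ccount N (s : 'S_N) :
  sumR [seq INR j * INR (Ccount j s) | j <- seq.iota 1 N] = INR N.
Proof.
rewrite sumR_big.
transitivity (INR (\sum_(j <- seq.iota 1 N) j * Ccount j s)).
  rewrite (big_morph INR plus_INR (erefl _)).
  by apply: eq_bigr => j _; rewrite -mult_INR.
congr INR; transitivity (\sum_(c in porbits s) #|c|)%N.
  rewrite -(big_cycle_length addn s (fun j => j)); apply: eq_bigr => j _.
  rewrite sum_nat_const mulnC; congr (_ * _)%N.
  by apply: eq_card => c; rewrite !inE.
rewrite -[RHS]card_ord -[RHS]sum1_card (partition_big (porbit s) (mem (porbits s))) /=.
  apply: eq_bigr => c /imsetP[y _ ->]; rewrite sum1dep_card; apply: eq_card => z.
  by rewrite inE eq_porbit_mem.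
by move=> y _; exact: imset_f.
Qed.

Lemma sumS_prod N (x : nat -> R) :
  sumS (fun s : 'S_N => prodR [seq x j ^ Ccount j s | j <- seq.iota 1 N]) =
  INR N`! * wcoef x N.
Proof.
have := cycleSumE x [set: 'I_N]; rewrite cardsT card_ord => <-.
rewrite sumS_big; apply: eq_big => [s|s _]; first by symmetry; apply/subsetP => y; rewrite inE.
by rewrite prod_Ccount; apply: eq_bigl => c; rewrite subsetT andbT.
Qed.

Section Model.
Variables theta kappa : nat -> R.
Hypothesis theta0 : forall j, (0 < j)%N -> 0 <= theta j.
Hypothesis kappa0 : forall j, (0 < j)%N -> 0 <= kappa j.

Definition rates (N j : nat) : R := theta j + INR N * kappa j.

Lemma rates_ge0 N j : (0 < j)%N -> 0 <= rates N j.
Proof.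
move=> j0; have := theta0 j0; have := kappa0 j0; have := pos_INR N.
rewrite /rates => *; nra.
Qed.

(** Hence [wcoef (rates N) N] is the normalization [H_N]. *)
Lemma sumS_weight N : sumS (weight theta kappa (N:=N)) = INR N`! * wcoef (rates N) N.
Proof. exact: sumS_prod. Qed.

Lemma weight_ge0 N (s : 'S_N) : 0 <= weight theta kappa s.
Proof.
rewrite /weight prodR_big big_seq; elim/big_ind: _ => [||j]; first lra.
  exact: Rmult_le_pos.
by rewrite mem_iota => /andP[j0 _]; apply/pow_le/(rates_ge0 N).
Qed.

Lemma EN_big N (X : 'S_N -> R) :
  EN theta kappa X = \big[Rplus/0]_(s : 'S_N) (X s * weight theta kappa s) /
    (INR N`! * wcoef (rates N) N).
Proof.
rewrite /EN sumS_big /Rdiv big_distrl /=; apply: eq_bigr => s _.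
by rewrite /PN sumS_weight /Rdiv Rmult_assoc.
Qed.

Lemma EN_sumR N (I : Type) (l : seq I) (a : I -> R) (X : I -> 'S_N -> R) :
  EN theta kappa (fun s => sumR [seq a i * X i s | i <- l]) =
  \big[Rplus/0]_(i <- l) (a i * EN theta kappa (X i)).
Proof.
rewrite /EN sumS_big.
transitivity (\big[Rplus/0]_(s : 'S_N) \big[Rplus/0]_(i <- l)
    (a i * (X i s * PN theta kappa s))).
  apply: eq_bigr => s _; rewrite sumR_big big_distrl /=.
  by apply: eq_bigr => i _; rewrite Rmult_assoc.
by rewrite exchange_big /=; apply: eq_bigr => i _; rewrite sumS_big big_distrr.
Qed.

Lemma EN_const N c : 0 < wcoef (rates N) N -> EN theta kappa (fun _ : 'S_N => c) = c.
Proof.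
move=> w0; rewrite EN_big -big_distrr /= -sumS_big sumS_weight.
have f0 : 0 < INR N`! by apply/lt_0_INR/ltP/fact_gt0.
field; lra.
Qed.

(* Jensen's inequality for the exponential moment of [C_j]: tilting [x_j] to
   [x_j e^t] multiplies each weight by [e^(t C_j)]. *)
Lemma EN_Ccount_le N j t : (0 < j <= N)%N -> 0 < wcoef (rates N) N ->
  exp (t * EN theta kappa (fun s : 'S_N => INR (Ccount j s))) * wcoef (rates N) N <=
  wcoef (fun i => if i == j then rates N i * exp t else rates N i) N.
Proof.
move=> jN w0; set x' := (fun i : nat => if _ then _ else _); set m := EN _ _ _.
have f0 : 0 < INR N`! by apply/lt_0_INR/ltP/fact_gt0.
apply: (Rmult_le_reg_l (INR N`!)) => //.
rewrite -(sumS_prod N x') sumS_big.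
have Hm : m * (INR N`! * wcoef (rates N) N) =
    \big[Rplus/0]_(s : 'S_N) (INR (Ccount j s) * weight theta kappa s).
  rewrite /m EN_big; field; lra.
have HW := sumS_weight N; rewrite sumS_big in HW.
have tilted (s : 'S_N) : prodR [seq x' i ^ Ccount i s | i <- seq.iota 1 N] =
    exp (t * INR (Ccount j s)) * weight theta kappa s.
  rewrite /weight !prodR_big.
  rewrite [LHS](eq_bigr (fun i => (if i == j then exp (t * INR (Ccount j s)) else 1) *
      rates N i ^ Ccount i s)); last first.
    move=> i _; rewrite /x'; case: eqP => [->|_]; last by rewrite Rmult_1_l.
    by rewrite Rpow_mult_distr Rmult_comm (Rmult_comm t) exp_mul_INR.
  rewrite big_split /= -big_mkcond /=; congr (_ * _).
  by rewrite big_pred1_seq ?iota_uniq // mem_iota add1n ltnS.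
(* The tangent bound [e^(t C) >= e^(t m) (1 + t C - t m)], with [C] the cycle count; the linear
   terms cancel on summation because [m] is the mean of [C]. *)
apply: (Rle_trans _ (\big[Rplus/0]_(s : 'S_N)
  (exp (t * m) * (1 + t * INR (Ccount j s) - t * m) * weight theta kappa s))).
  rewrite (eq_bigr (fun s : 'S_N => exp (t * m) * (1 - t * m) * weight theta kappa s +
     exp (t * m) * t * (INR (Ccount j s) * weight theta kappa s))); last by move=> s _; ring.
  rewrite big_split /= -!big_distrr /= HW -Hm; apply: Req_le; ring.
apply: bigR_le => s _; rewrite tilted; apply: Rmult_le_compat_r; first exact: weight_ge0.
have -> : t * INR (Ccount j s) = t * m + (t * INR (Ccount j s) - t * m) by ring.
rewrite exp_plus; apply: Rmult_le_compat_l; first exact/Rlt_le/exp_pos.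
by apply: Rle_trans (exp_ineq1_le _); lra.
Qed.

(** The cycle lengths add up to [N], so the tail is the complement of [K] expectations, a number of
    terms that does not grow with [N]. *)
Lemma tailmassE K N : (K <= N)%N -> (0 < N)%N -> 0 < wcoef (rates N) N ->
  tailmass theta kappa K N =
  1 - \big[Rplus/0]_(1 <= j < K.+1)
        (INR j * (EN theta kappa (fun s : 'S_N => INR (Ccount j s)) / INR N)).
Proof.
move=> KN N0 w0; rewrite /tailmass.
have RN : 0 < INR N by exact: lt_0_INR (ltP _).
have := @EN_const N (INR N) w0.
have -> : EN theta kappa (fun _ : 'S_N => INR N) =
    EN theta kappa (fun s : 'S_N => sumR [seq INR j * INR (Ccount j s) | j <- seq.iota 1 N]).
  by rewrite !EN_big; congr (_ / _); apply: eq_bigr => s _; rewrite sum_Ccount.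
rewrite !(EN_sumR _ INR (fun j (s : 'S_N) => INR (Ccount j s))).
rewrite -{1}(subnKC KN) iotaD big_cat /= add1n => H.
rewrite [X in _ = 1 - X](eq_bigr (fun j => INR j *
   EN theta kappa (fun s : 'S_N => INR (Ccount j s)) * / INR N)); last first.
  by move=> j _; rewrite /Rdiv Rmult_assoc.
rewrite -big_distrl /= /index_iota subn1 /=.
move: H; set a := \big[_/_]_(j <- _) _; set b := \big[_/_]_(j <- _) _ => H.
have -> : b = INR N - a by lra.
field; lra.
Qed.

End Model.

(** * Limits of the expected cycle counts and of the tail mass *)

Lemma bounded_almost_max (u : nat -> R) B eps : (forall n, u n <= B) -> 0 < eps ->
  exists J, forall n, u n <= u J + eps.
Proof.
move=> uB eps0.
have [||l [ub lub]] := completeness (fun x => exists n, x = u n).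
- by exists B => x [n ->].
- by exists (u 0%N), 0%N.
have [J HJ] : exists J, l - eps < u J.
  apply: NNPP => no; suff : l <= l - eps by lra.
  by apply: lub => x [n ->]; apply: Rnot_lt_le => h; apply: no; exists n.
by exists J => n; have := ub (u n) (ex_intro _ n erefl); lra.
Qed.

(** From [e^t (1 - t) <= 1] and [(1 - t)(1 + t + 2 t^2) = 1 + t^2 (1 - 2 t)]. *)
Lemma exp_le_quadratic t : t <= 1 / 2 -> exp t <= 1 + t + 2 * t ^ 2.
Proof.
move=> t2; have H := exp_ineq1_le (- t); rewrite exp_Ropp in H.
have p := exp_pos t.
have H2 : exp t * (1 - t) <= 1.
  by rewrite -[X in _ <= X](Rinv_r (exp t)); [apply: Rmult_le_compat_l; lra | lra].
have H3 : 0 <= t ^ 2 * (1 - 2 * t) by apply: Rmult_le_pos; [exact: pow2_ge_0 | lra].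
apply: (Rmult_le_reg_r (1 - t)); first lra.
apply: Rle_trans H2 _; nra.
Qed.

Section Limit.
Variables theta kappa : nat -> R.
Hypothesis theta0 : forall j, (0 < j)%N -> 0 <= theta j.
Hypothesis kappa0 : forall j, (0 < j)%N -> 0 <= kappa j.
Hypothesis nonar : non_arithmetic kappa.
Hypothesis knz : exists j : nat, leq 2 j /\ 0 < kappa j.

Variable rstar : R.
Hypothesis rstar0 : 0 < rstar.
Hypothesis theta_bounded : forall rho, 0 < rho < rstar ->
  exists T, forall n, \big[Rplus/0]_(1 <= j < n.+1) (theta j * rho ^ j / INR j) <= T.
Hypothesis kappa_below : forall rho n, 0 < rho < rstar ->
  \big[Rplus/0]_(1 <= j < n.+1) (kappa j * rho ^ j) <= 1.
Hypothesis kappa_above : forall r, rstar < r ->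
  exists J, 1 <= \big[Rplus/0]_(1 <= j < J.+1) (kappa j * r ^ j).

Lemma kappa_pow_ge0 j r : (0 < j)%N -> 0 <= r -> 0 <= kappa j * r ^ j.
Proof. by move=> j0 r0; apply: Rmult_le_pos; [exact: kappa0 | exact: pow_le]. Qed.

Lemma wcoef_rates_lower rho r eps : 0 < rho < rstar -> rstar < r -> 0 < eps ->
  exists N1, forall N, (N1 <= N)%N ->
    exp (INR N * (\big[Rplus/0]_(1 <= j < N.+1) (kappa j * rho ^ j / INR j) - ln r - eps))
    <= wcoef (rates theta kappa N) N.
Proof.
move=> rho_lt r_gt eps0; have e2 : 0 < eps / 2 by lra.
pose P s n := \big[Rplus/0]_(1 <= j < n.+1) (kappa j * s ^ j / INR j).
have INRj j : (0 < j)%N -> 1 <= INR j by move=> j0; apply: (le_INR 1); exact/leP.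
have P1 n : P rho n <= 1.
  apply: Rle_trans (kappa_below n rho_lt).
  apply: bigR_nat_le => j /andP[j0 _]; have h := INRj j j0.
  have k0 : 0 <= kappa j * rho ^ j by apply: kappa_pow_ge0 => //; lra.
  apply: (Rmult_le_reg_r (INR j)); first lra.
  rewrite /Rdiv Rmult_assoc Rinv_l; last lra.
  by rewrite Rmult_1_r -[X in X <= _]Rmult_1_r; apply: Rmult_le_compat_l.
have [J0 HJ0] := bounded_almost_max P1 e2.
have [J1 HJ1] := kappa_above r_gt.
(* [J0] brings the sum at [rho] within [eps / 2] of its supremum, uniformly in [N]; [J1] makes the
   truncated sum reach 1 by [r], so that the equation has a solution [s] in [[rho, r]]. *)
pose J := maxn J0 J1.
pose f s := \big[Rplus/0]_(1 <= j < J.+1) (kappa j * s ^ j).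
have cf : Ranalysis1.continuity f.
  move=> s; apply/continuity_pt_filterlim/ex_derive_continuous; eexists.
  apply: (@is_derive_bigR _ _ (fun j u => kappa j * u ^ j)
    (fun j u => kappa j * (INR j * u ^ j.-1))) => k _.
  by auto_derive; [|ring].
have f_rho : f rho <= 1 by exact: kappa_below.
have f_r : 1 <= f r.
  apply: Rle_trans HJ1 _; apply: bigR_nat_widen; first by rewrite /= ltnS leq_maxr.
  by move=> i /andP[i0 _]; apply: kappa_pow_ge0; [exact: leq_trans i0 | lra].
have [s [s_lt fs]] : exists s, rho <= s <= r /\ f s = 1.
  have [|s [h fs]] := IVT_gen f rho r 1 cf.
    by rewrite Rmin_left ?Rmax_right //; lra.
  by exists s; rewrite Rmin_left ?Rmax_right in h; lra.
have s0 : 0 < s by lra.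
have [N1 HN1] := diagCoef_lower kappa0 nonar knz s0 e2 fs.
exists N1 => N /HN1 H.
apply: (Rle_trans _ (diagCoef kappa N)); last first.
  apply: wcoef_le => j j0; rewrite /rates; have := theta0 j0.
  have : 0 <= INR N * kappa j by apply: Rmult_le_pos; [exact: pos_INR | exact: kappa0].
  lra.
apply: Rle_trans H; apply: exp_le; apply: Rmult_le_compat_l; first exact: pos_INR.
have h1 := HJ0 N; rewrite /P in h1.
have h2 : P rho J0 <= P rho J.
  apply: bigR_nat_widen; first by rewrite /= ltnS leq_maxl.
  move=> i /andP[i0 _]; have i1 : (0 < i)%N by exact: leq_trans i0.
  apply: Rle_mult_inv_pos; last by have := INRj i i1; lra.
  by apply: kappa_pow_ge0 => //; lra.
have h3 : P rho J <= P s J.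
  apply: bigR_nat_le => i /andP[i0 _]; have h := INRj i i0.
  apply: Rmult_le_compat_r; first by apply/Rlt_le/Rinv_0_lt_compat; lra.
  by apply: Rmult_le_compat_l; [exact: kappa0 | apply: pow_incr; lra].
have h4 : ln s <= ln r by apply: ln_le; lra.
by move: h2 h3; rewrite /P => h2 h3; lra.
Qed.

(** Combines [EN_Ccount_le] with [wcoef_upper] at [rho] for the tilted rates: [theta] contributes
    the constant [T], and the tilt alters only the term of index [j]. *)
Lemma EN_Ccount_bound rho r eps : 0 < rho < rstar -> rstar < r -> 0 < eps ->
  exists T N1, forall N j t, (N1 <= N)%N -> (0 < j <= N)%N ->
    t * EN theta kappa (fun s : 'S_N => INR (Ccount j s)) <=
    T + INR N * (ln r - ln rho + eps) +
    (exp t - 1) * (rates theta kappa N j * rho ^ j / INR j).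
Proof.
move=> rho_lt r_gt eps0.
have [N1 HN1] := wcoef_rates_lower rho_lt r_gt eps0.
have [T HT] := theta_bounded rho_lt.
exists T, N1 => N j t NN1 jN.
have rho0 : 0 < rho by lra.
have lower := HN1 N NN1.
have w0 : 0 < wcoef (rates theta kappa N) N by apply: Rlt_le_trans lower; exact: exp_pos.
have tilt := EN_Ccount_le theta0 kappa0 t jN w0.
set m := EN _ _ _ in tilt *.
set x' := (fun i : nat => if _ then _ else _) in tilt.
have x'0 i : (0 < i)%N -> 0 <= x' i.
  move=> i0; rewrite /x'; have := rates_ge0 theta0 kappa0 N i0.
  by case: eqP => // _ h; apply: Rmult_le_pos => //; exact/Rlt_le/exp_pos.
have upper := wcoef_upper N x'0 (Rlt_le _ _ rho0).
pose q := (exp t - 1) * (rates theta kappa N j * rho ^ j / INR j).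
have sumE : \big[Rplus/0]_(1 <= i < N.+1) (x' i * rho ^ i / INR i) =
    \big[Rplus/0]_(1 <= i < N.+1) (theta i * rho ^ i / INR i) +
    INR N * \big[Rplus/0]_(1 <= i < N.+1) (kappa i * rho ^ i / INR i) + q.
  have -> : q = \big[Rplus/0]_(1 <= i < N.+1 | i == j)
      ((exp t - 1) * (rates theta kappa N i * rho ^ i / INR i)).
    by rewrite big_pred1_seq ?iota_uniq // mem_index_iota ltnS.
  rewrite big_distrr /= -big_split /= [X in _ = _ + X]big_mkcond -big_split /=.
  apply: eq_bigr => i _; rewrite /x' /rates /Rdiv; case: eqP => _; ring.
have lnr : rho ^ N = exp (INR N * ln rho) by rewrite exp_mul_INR exp_ln.
have : exp (t * m + INR N * (\big[Rplus/0]_(1 <= i < N.+1) (kappa i * rho ^ i / INR i)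
     - ln r - eps) + INR N * ln rho) <=
   exp (\big[Rplus/0]_(1 <= i < N.+1) (x' i * rho ^ i / INR i)).
  rewrite 2!exp_plus -lnr; apply: Rle_trans upper.
  apply: Rmult_le_compat_r; first by apply: pow_le; lra.
  apply: Rle_trans tilt; apply: Rmult_le_compat_l => //; exact/Rlt_le/exp_pos.
have := HT N; rewrite sumE.
set A := \big[Rplus/0]_(_ <= _ < _) _; set B := \big[Rplus/0]_(_ <= _ < _) _ => HA.
rewrite -/q => H.
have {}H : t * m + INR N * (B - ln r - eps) + INR N * ln rho <= A + INR N * B + q.
  by apply: Rnot_lt_le => /exp_increasing; lra.
lra.
Qed.

Lemma wcoef_rates_gt0 : exists N1, forall N, (N1 <= N)%N -> 0 < wcoef (rates theta kappa N) N.
Proof.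
have h1 : 0 < rstar / 2 < rstar by lra.
have h2 : rstar < 2 * rstar by lra.
have [N1 HN1] := wcoef_rates_lower h1 h2 Rlt_0_1.
by exists N1 => N /HN1; apply: Rlt_le_trans; exact: exp_pos.
Qed.

Lemma EN_Ccount_lim j : (0 < j)%N ->
  is_lim_seq (fun N => EN theta kappa (fun s : 'S_N => INR (Ccount j s)) / INR N)
    (kappa j * rstar ^ j / INR j).
Proof.
move=> j0; set q := kappa j * rstar ^ j / INR j.
have Rj : 0 < INR j by exact: lt_0_INR (ltP _).
have q0 : 0 <= q by apply: Rle_mult_inv_pos => //; apply: kappa_pow_ge0 => //; lra.
apply/is_lim_seq_spec => -[eps eps0] /=.
(* Dominates the multiples of [t] in the two final estimates, [1 + 2 q] above and [4/5 + 2 q + j q]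
   below. *)
pose c := 2 + 3 * q + INR j * q.
have c0 : 0 < c by rewrite /c; have := Rmult_le_pos _ _ (Rlt_le _ _ Rj) q0; lra.
pose t := Rmin (1 / 2) (eps / (2 * c)).
have t0 : 0 < t by apply: Rmin_pos; [lra | apply: Rdiv_lt_0_compat; lra].
have t2 : t <= 1 / 2 by exact: Rmin_l.
have tc : t * c < eps.
  have : t * c <= eps / (2 * c) * c by apply: Rmult_le_compat_r; [lra | exact: Rmin_r].
  have -> : eps / (2 * c) * c = eps / 2 by field; lra.
  lra.
(* The radii [rstar e^h] and [rstar e^(-h)] with slack [h] cost [3 h] per unit of [N], and one more
   [h] absorbs [T] and the part of [theta]; [5 h = t^2] is still negligible after division by
   [t]. *)
pose h := t ^ 2 / 5.
have tt0 : 0 < t ^ 2 by exact: pow_lt.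
have h0 : 0 < h by rewrite /h; lra.
have rho_lt : 0 < rstar * exp (- h) < rstar.
  split; first by apply: Rmult_lt_0_compat => //; exact: exp_pos.
  rewrite -[X in _ < X]Rmult_1_r; apply: Rmult_lt_compat_l => //.
  by rewrite -exp_0; apply: exp_increasing; lra.
have r_gt : rstar < rstar * exp h.
  rewrite -[X in X < _]Rmult_1_r; apply: Rmult_lt_compat_l => //.
  by rewrite -exp_0; apply: exp_increasing; lra.
have [T [N1 HN]] := EN_Ccount_bound rho_lt r_gt h0.
have lnE : ln (rstar * exp h) - ln (rstar * exp (- h)) + h = 3 * h.
  by rewrite !ln_mult ?ln_exp //; try exact: exp_pos; lra.
rewrite lnE in HN.
pose qr := kappa j * (rstar * exp (- h)) ^ j / INR j.
have qrE : qr = q * exp (- (INR j * h)).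
  rewrite /qr /q Rpow_mult_distr -exp_mul_INR.
  have -> : INR j * - h = - (INR j * h) by ring.
  by field; lra.
have jh0 : 0 < INR j * h by exact: Rmult_lt_0_compat.
have qr_le : 0 <= qr <= q.
  rewrite qrE; split; first by apply: Rmult_le_pos => //; exact/Rlt_le/exp_pos.
  rewrite -[X in _ <= X]Rmult_1_r; apply: Rmult_le_compat_l => //.
  by rewrite -exp_0; apply: exp_le; lra.
have qr_ge : q * (1 - INR j * h) <= qr.
  rewrite qrE; apply: Rmult_le_compat_l => //.
  by have := exp_ineq1_le (- (INR j * h)); lra.
pose a := theta j * (rstar * exp (- h)) ^ j / INR j.
have a0 : 0 <= a.
  by apply: Rle_mult_inv_pos => //; apply: Rmult_le_pos; [exact: theta0 | apply: pow_le; lra].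
have [N2 HN2] := INR_archimed h (Rabs T + a) h0.
exists (maxn N1 (maxn N2 j)) => N /leP; rewrite !geq_max => /and3P[n1 n2 nj].
have N0 : 0 < INR N by apply/lt_0_INR/ltP/(leq_trans j0).
set m := EN _ _ _; set u := m / INR N.
have mE : m = u * INR N by rewrite /u; field; lra.
have N2h : Rabs T + a <= INR N * h.
  have : INR N2 * h <= INR N * h by apply: Rmult_le_compat_r; [lra | exact/le_INR/leP].
  by lra.
have T1 : T <= Rabs T by exact: Rle_abs.
have T2 : 0 <= Rabs T by exact: Rabs_pos.
have jN : (0 < j <= N)%N by rewrite j0.
have ratesE : rates theta kappa N j * (rstar * exp (- h)) ^ j / INR j = a + INR N * qr.
  by rewrite /rates /a /qr; field; lra.
have up := HN N j t n1 jN; have low := HN N j (- t) n1 jN.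
rewrite -/m mE ratesE in up low.
have e1 := exp_le_quadratic t2.
have e2 : exp (- t) <= 1 - t + 2 * t ^ 2 by have := @exp_le_quadratic (- t); lra.
have tt : 2 * t ^ 2 <= t by nra.
have Nqr : 0 <= INR N * qr by apply: Rmult_le_pos; lra.
have Nqrq : INR N * qr <= INR N * q by apply: Rmult_le_compat_l; lra.
have u_le : t * u <= 5 * h + (t + 2 * t ^ 2) * q.
  apply: (Rmult_le_reg_r (INR N)) => //.
  have g1 : (exp t - 1) * (a + INR N * qr) <= (t + 2 * t ^ 2) * (a + INR N * qr).
    by apply: Rmult_le_compat_r; lra.
  have g2 : (t + 2 * t ^ 2) * (INR N * qr) <= (t + 2 * t ^ 2) * (INR N * q).
    by apply: Rmult_le_compat_l; lra.
  have g3 : (t + 2 * t ^ 2) * a <= 1 * a by apply: Rmult_le_compat_r; lra.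
  lra.
have u_ge : (t - 2 * t ^ 2) * qr - 4 * h <= t * u.
  apply: (Rmult_le_reg_r (INR N)) => //.
  have g1 : (exp (- t) - 1) * (a + INR N * qr) <= (- t + 2 * t ^ 2) * (a + INR N * qr).
    by apply: Rmult_le_compat_r; lra.
  have g2 : 0 <= (t - 2 * t ^ 2) * a by apply: Rmult_le_pos; lra.
  lra.
apply: Rabs_def1.
  apply: (Rmult_lt_reg_l t) => //.
  have : t * (t * c) < t * eps by apply: Rmult_lt_compat_l.
  have g1 : 0 <= t ^ 2 * q by apply: Rmult_le_pos; lra.
  have g2 : 0 <= t ^ 2 * (INR j * q) by do 2?apply: Rmult_le_pos; lra.
  rewrite /c; rewrite /h in u_le; nra.
apply: (Rmult_lt_reg_l t) => //.
have : t * (t * c) < t * eps by apply: Rmult_lt_compat_l.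
have g1 : (t - 2 * t ^ 2) * (q * (1 - INR j * h)) <= (t - 2 * t ^ 2) * qr.
  by apply: Rmult_le_compat_l; lra.
have jhq : 0 <= INR j * h * q by apply: Rmult_le_pos; lra.
have g2 : 0 <= 2 * t ^ 2 * (INR j * h * q) by apply: Rmult_le_pos; lra.
have jq : 0 <= INR j * q by apply: Rmult_le_pos; lra.
have g3 : t * (INR j * h * q) <= t ^ 2 * (INR j * q).
  have -> : t * (INR j * h * q) = (t * h) * (INR j * q) by ring.
  apply: Rmult_le_compat_r => //; rewrite /h.
  have : t * t ^ 2 <= 1 * t ^ 2 by apply: Rmult_le_compat_r; lra.
  lra.
have g4 : 0 <= t ^ 2 * q by apply: Rmult_le_pos; lra.
rewrite /c; rewrite /h in u_ge g1 g2 g3 *; nra.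
Qed.

Lemma is_lim_seq_bigR (I : Type) (l : seq I) (u : I -> nat -> R) (v : I -> R) :
  (forall i, is_lim_seq (u i) (v i)) ->
  is_lim_seq (fun n => \big[Rplus/0]_(i <- l) u i n) (\big[Rplus/0]_(i <- l) v i).
Proof.
move=> uv; elim: l => [|i l IH].
  rewrite big_nil; apply: (is_lim_seq_ext (fun=> 0)) => [n|]; first by rewrite big_nil.
  exact: is_lim_seq_const.
rewrite big_cons.
apply: (is_lim_seq_ext (fun n => u i n + \big[Rplus/0]_(i <- l) u i n)).
  by move=> n; rewrite big_cons.
exact: is_lim_seq_plus'.
Qed.

Lemma tailmass_lim K :
  is_lim_seq (tailmass theta kappa K)
    (1 - \big[Rplus/0]_(1 <= j < K.+1) (kappa j * rstar ^ j)).
Proof.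
have [N1 HN1] := wcoef_rates_gt0.
pose u N := 1 - \big[Rplus/0]_(1 <= j < K.+1)
   (INR j * (EN theta kappa (fun s : 'S_N => INR (Ccount j s)) / INR N)).
apply: (is_lim_seq_ext_loc u).
  exists (maxn N1 (maxn K 1)) => N /leP; rewrite !geq_max => /and3P[n1 nK n0].
  by rewrite tailmassE //; exact: HN1.
apply: is_lim_seq_minus'; first exact: is_lim_seq_const.
have -> : \big[Rplus/0]_(1 <= j < K.+1) (kappa j * rstar ^ j) =
  \big[Rplus/0]_(1 <= j < K.+1) (INR j * (kappa j * rstar ^ j / INR j)).
  apply: eq_big_nat => j /andP[j0 _]; field.
  by apply: not_0_INR; case: j j0.
(* [is_lim_seq_bigR] asks for a limit at every index; at index 0, outside the range, the factor
   [INR 0] makes both sides vanish. *)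
apply: is_lim_seq_bigR => -[|j].
  apply: (is_lim_seq_ext (fun=> 0)) => [n|]; first by rewrite /= Rmult_0_l.
  by rewrite /= Rmult_0_l; exact: is_lim_seq_const.
have := EN_Ccount_lim (ltn0Sn j) => /(is_lim_seq_scal_l _ (INR j.+1)).
exact.
Qed.

End Limit.

(** * Radius of convergence and the critical point *)

Lemma sum_n_bigR (f : nat -> R) n : sum_n f n = \big[Rplus/0]_(0 <= j < n.+1) f j.
Proof.
elim: n => [|n IH]; first by rewrite sum_O big_nat1.
by rewrite sum_Sn IH (big_nat_recr n.+1).
Qed.

Lemma coef_sum (a : nat -> R) r n :
  \big[Rplus/0]_(1 <= j < n.+1) (a j * r ^ j / INR j) =
  \big[Rplus/0]_(0 <= j < n.+1) (coef a j * r ^ j).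
Proof.
rewrite [RHS](big_ltn (ltn0Sn n)) /= Rmult_0_l Rplus_0_l.
by apply: eq_big_nat => -[//|j] _; rewrite /coef /Rdiv; ring.
Qed.

Lemma coef_ge0 (a : nat -> R) r j : (forall j, (0 < j)%N -> 0 <= a j) -> 0 <= r ->
  0 <= coef a j * r ^ j.
Proof.
move=> a0 r0; apply: Rmult_le_pos; last exact: pow_le.
case: j => [|j]; first exact: Rle_refl.
by apply: Rle_mult_inv_pos; [exact: a0 | exact: lt_0_INR (ltP _)].
Qed.

Lemma coef_sum_bounded (a : nat -> R) r : (forall j, (0 < j)%N -> 0 <= a j) -> 0 <= r ->
  Rbar_lt r (CV_radius (coef a)) ->
  exists T, forall n, \big[Rplus/0]_(1 <= j < n.+1) (a j * r ^ j / INR j) <= T.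
Proof.
move=> a0 r0; rewrite -{1}(Rabs_pos_eq _ r0) => /CV_radius_inside /PSeries_correct.
rewrite is_pseries_R => H; exists (PSeries (coef a) r) => n.
rewrite coef_sum -(sum_n_bigR (fun j => coef a j * r ^ j)).
apply: (is_lim_seq_incr_compare _ _ H) => k.
by rewrite sum_Sn /plus /=; have := coef_ge0 k.+1 a0 r0; rewrite /=; lra.
Qed.

Lemma sum_n_RtoC (a : nat -> R) r n :
  sum_n (fun k => scal (pow_n (RtoC r : C_AbsRing) k) (RtoC (a k) : C_NormedModule)) n =
  RtoC (sum_n (fun k => a k * r ^ k) n).
Proof.
have powE k : pow_n (RtoC r : C_AbsRing) k = RtoC (r ^ k).
  by elim: k => [|k IH] //=; rewrite IH RtoC_mult.
have scalE k : scal (pow_n (RtoC r : C_AbsRing) k) (RtoC (a k) : C_NormedModule) =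
    RtoC (a k * r ^ k).
  by rewrite powE /scal /= /mult /= -RtoC_mult Rmult_comm.
elim: n => [|n IH]; first by rewrite !sum_O scalE.
by rewrite !sum_Sn IH scalE /plus /= -RtoC_plus.
Qed.

(** Serves (Sup-0), where the convergence of the series of [theta] is given over the complex
    numbers. At a real point the partial sums are real and nondecreasing, so being eventually within
    1 of [l] bounds them all. *)
Lemma coef_sum_bounded_C (a : nat -> R) r (l : C) :
  (forall j, (0 < j)%N -> 0 <= a j) -> 0 <= r ->
  is_pseries (fun j => RtoC (coef a j)) (RtoC r : C_AbsRing) (l : C_NormedModule) ->
  exists T, forall n, \big[Rplus/0]_(1 <= j < n.+1) (a j * r ^ j / INR j) <= T.
Proof.
move=> a0 r0 H.
have /filterlim_locally_ball_norm /(_ (mkposreal 1 Rlt_0_1)) [N HN] := H.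
exists (fst l + 1) => n; rewrite coef_sum.
apply: (Rle_trans _ (\big[Rplus/0]_(0 <= j < (maxn n N).+1) (coef a j * r ^ j))).
  apply: bigR_nat_widen; first by rewrite /= ltnS leq_maxl.
  by move=> i _; exact: coef_ge0.
have /HN : (N <= maxn n N)%coq_nat by apply/leP; exact: leq_maxr.
rewrite /ball_norm sum_n_RtoC /= -sum_n_bigR.
set S := sum_n _ _ => HS.
have := Rle_lt_trans _ _ _ (re_le_Cmod _) HS.
by move=> /Rabs_def2 [/= h _]; move: h; rewrite /opp /plus /=; lra.
Qed.

Section PowerSums.
Variable kappa : nat -> R.
Hypothesis kappa0 : forall j, (0 < j)%N -> 0 <= kappa j.

Definition powerSum (r : R) (n : nat) : R := \big[Rplus/0]_(1 <= j < n.+1) (kappa j * r ^ j).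

Lemma powerSum_le r s m n : 0 <= r <= s -> (m <= n)%N -> powerSum r m <= powerSum s n.
Proof.
move=> rs mn; apply: (Rle_trans _ (powerSum s m)).
  apply: bigR_nat_le => j /andP[j0 _]; apply: Rmult_le_compat_l; first exact: kappa0.
  exact: pow_incr.
apply: bigR_nat_widen; first by rewrite /= ltnS.
by move=> j /andP[j0 _]; apply: kappa_pow_ge0; [exact: kappa0 | exact: leq_trans j0 | lra].
Qed.

Lemma powerSum_incr r : 0 <= r -> forall n, powerSum r n <= powerSum r n.+1.
Proof. by move=> r0 n; apply: powerSum_le => //; lra. Qed.

Lemma powerSum_lim r : 0 < r -> Rbar_lt r (CV_radius (coef kappa)) ->
  is_lim_seq (powerSum r) (gbr kappa 1 r).
Proof.
move=> r0 rR; have rR' : Rbar_lt (Rabs r) (CV_radius (coef kappa)).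
  by rewrite Rabs_pos_eq //; lra.
have := rR'; rewrite -CV_radius_derive => /CV_radius_inside /PSeries_correct.
rewrite -Derive_PSeries // is_pseries_R => H.
apply/is_lim_seq_incr_1.
have -> : gbr kappa 1 r = r * Derive (PSeries (coef kappa)) r.
  by rewrite /gbr /= Rmult_1_r.
apply: (is_lim_seq_ext _ _ _ _ (is_lim_seq_scal_l _ r (Finite _) H)) => n.
rewrite sum_n_bigR /powerSum big_add1 big_distrr /=; apply: eq_bigr => j _.
by rewrite /PS_derive /coef; field; exact: not_0_INR.
Qed.

Lemma powerSum_le_gbr r n : 0 < r -> Rbar_lt r (CV_radius (coef kappa)) ->
  powerSum r n <= gbr kappa 1 r.
Proof.
move=> r0 rR; apply: (is_lim_seq_incr_compare _ _ (powerSum_lim r0 rR)).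
by apply: powerSum_incr; lra.
Qed.

Lemma gbr_le r s : 0 < r <= s -> Rbar_lt s (CV_radius (coef kappa)) ->
  gbr kappa 1 r <= gbr kappa 1 s.
Proof.
move=> [r0 rs] sR; have rR : Rbar_lt r (CV_radius (coef kappa)).
  by apply: Rbar_le_lt_trans sR.
have s0 : 0 < s by lra.
have := is_lim_seq_le _ _ _ _ _ (powerSum_lim r0 rR) (powerSum_lim s0 sR).
by apply=> n; apply: powerSum_le => //; lra.
Qed.

Lemma powerSum_interior r : 0 < r -> Rbar_lt r (CV_radius (coef kappa)) ->
  gbr kappa 1 r = 1 ->
  [/\ forall rho n, 0 < rho < r -> powerSum rho n <= 1,
      forall s, r < s -> exists J, 1 <= powerSum s J
    & is_lim_seq (powerSum r) 1].
Proof.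
move=> r0 rR g1; have lim := powerSum_lim r0 rR; rewrite g1 in lim; split => //.
  move=> rho n rho_lt; rewrite -g1; apply: Rle_trans (powerSum_le_gbr n r0 rR).
  by apply: powerSum_le => //; lra.
(* As [s] may lie beyond the radius of convergence, partial sums are compared: if all those at [s]
   were below 1, those at [r] would be at most [r / s < 1], against their limit 1. *)
move=> s rs; apply: NNPP => no.
have s0 : 0 < s by lra.
have rs1 : 0 < r / s < 1.
  split; first exact: Rdiv_lt_0_compat.
  by apply: (Rmult_lt_reg_r s) => //; rewrite /Rdiv Rmult_assoc Rinv_l; lra.
suff : Rbar_le 1 (r / s) by rewrite /=; lra.
apply: (is_lim_seq_le _ _ _ _ _ lim (is_lim_seq_const (r / s))) => n.
apply: (Rle_trans _ (r / s * powerSum s n)); last first.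
  rewrite -[X in _ <= X]Rmult_1_r; apply: Rmult_le_compat_l; first lra.
  by apply: Rlt_le; apply: Rnot_le_lt => h; apply: no; exists n.
rewrite /powerSum big_distrr /=; apply: bigR_nat_le => -[//|j] _.
have -> : kappa j.+1 * r ^ j.+1 = r / s * (kappa j.+1 * (r ^ j * s)).
  by rewrite /=; field; lra.
apply: Rmult_le_compat_l; first lra.
apply: Rmult_le_compat_l; first exact: kappa0.
rewrite [s ^ j.+1]/= Rmult_comm; apply: Rmult_le_compat_l; first lra.
by apply: pow_incr; lra.
Qed.

(** Since the terms are nonnegative, the left limit [g1R] is the sum of the series at [r]: left
    continuity of each partial sum gives one inequality, monotonicity in the radius the other. *)
Lemma powerSum_boundary r (g1R : Rbar) : 0 < r -> CV_radius (coef kappa) = Finite r ->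
  gbR kappa r 1 g1R -> Rbar_le g1R 1 ->
  exists c, [/\ g1R = Finite c,
      forall rho n, 0 < rho < r -> powerSum rho n <= 1,
      forall s, r < s -> exists J, 1 <= powerSum s J
    & is_lim_seq (powerSum r) c].
Proof.
move=> r0 rad lim g1_le.
have inR rho : rho < r -> Rbar_lt rho (CV_radius (coef kappa)) by rewrite rad.
have nearby rho : rho < r -> at_left r (fun s => rho < s < r).
  move=> rho_lt; have p : 0 < r - rho by lra.
  exists (mkposreal _ p) => s; rewrite /ball /= /AbsRing_ball /abs /minus /plus /opp /=.
  by move=> /Rabs_def2; lra.
have g_le rho : 0 < rho < r -> Rbar_le (gbr kappa 1 rho) g1R.
  move=> rho_lt.
  apply: (@filterlim_le _ (at_left r) _ (fun=> gbr kappa 1 rho) (gbr kappa 1)).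
  - apply: filter_imp (nearby rho _) => [s s_lt|]; last lra.
    by apply: gbr_le; [lra | apply: inR; lra].
  - exact: filterlim_const.
  - exact: lim.
have r2 : 0 < r / 2 < r by lra.
have [c Ec] : exists c, g1R = Finite c.
  by case: (g1R) g1_le (g_le _ r2) => [c|//|//] _ _; exists c.
rewrite Ec /= in g1_le g_le lim; exists c.
have S_le rho n : 0 < rho < r -> powerSum rho n <= c.
  move=> rho_lt; apply: Rle_trans (g_le rho rho_lt).
  by apply: powerSum_le_gbr; [lra | apply: inR; lra].
have Sr_le n : powerSum r n <= c.
  have : Rbar_le (powerSum r n) c.
    apply: (@filterlim_le _ (at_left r) _ (fun s => powerSum s n) (fun=> c)).
    - apply: filter_imp (nearby 0 r0) => s s_lt; exact: S_le.
    - have : continuous (fun s => powerSum s n) r.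
        apply: ex_derive_continuous; eexists.
        apply: (@is_derive_bigR _ _ (fun j u => kappa j * u ^ j)
          (fun j u => kappa j * (INR j * u ^ j.-1))) => k _.
        by auto_derive; [|ring].
      move=> cont; apply: filterlim_filter_le_1 cont; exact: filter_le_within.
    - exact: filterlim_const.
  exact.
split => //.
- by move=> rho n /S_le h; exact: Rle_trans (h n) g1_le.
(* Partial sums below 1 at [s] would bound the terms of [coef kappa] at [s], and the radius of
   convergence would be at least [s]. *)
- move=> s rs; apply: NNPP => no.
  have [ub _] := CV_radius_bounded (coef kappa).
  suff : Rbar_le s (CV_radius (coef kappa)) by rewrite rad /=; lra.
  apply: ub; exists 1 => -[|n]; first by rewrite /= Rmult_0_l Rabs_R0; lra.
  have s0 : 0 <= s by lra.
  rewrite Rabs_pos_eq; last exact: coef_ge0.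
  apply: (Rle_trans _ (powerSum s n.+1)).
    have Rn : 1 <= INR n.+1 by apply: (le_INR 1); exact/leP.
    have k0 : 0 <= kappa n.+1 * s ^ n.+1 by exact: kappa_pow_ge0.
    apply: (Rle_trans _ (kappa n.+1 * s ^ n.+1)).
      rewrite /coef -/(INR n.+1) (_ : _ / _ * _ = kappa n.+1 * s ^ n.+1 / INR n.+1); last first.
        by rewrite /Rdiv; ring.
      apply: (Rmult_le_reg_r (INR n.+1)); first lra.
      rewrite /Rdiv Rmult_assoc Rinv_l; last lra.
      by rewrite Rmult_1_r -[X in X <= _]Rmult_1_r; apply: Rmult_le_compat_l.
    rewrite /powerSum (big_nat_recr n.+1) //= -[X in X <= _]Rplus_0_l.
    apply: Rplus_le_compat_r; apply: bigR_nat_ge0 => j /andP[j0 _].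
    exact: kappa_pow_ge0.
  by apply: Rlt_le; apply: Rnot_le_lt => h; apply: no; exists n.+1.
have [l Hl] : ex_finite_lim_seq (powerSum r).
  by apply: (ex_finite_lim_seq_incr _ c) => //; apply: powerSum_incr; lra.
have lc : l <= c.
  have := is_lim_seq_le _ _ _ _ Sr_le Hl (is_lim_seq_const c); exact.
have cl : c <= l.
  have : Rbar_le c l.
    apply: (@filterlim_le _ (at_left r) _ (gbr kappa 1) (fun=> l)); last 2 first.
    - exact: lim.
    - exact: filterlim_const.
    apply: filter_imp (nearby 0 r0) => s s_lt.
    have s0 : 0 < s by lra.
    have sr : s < r by lra.
    have := is_lim_seq_le _ _ _ _ _ (powerSum_lim s0 (inR s sr)) Hl.
    by apply=> n; apply: powerSum_le => //; lra.
  exact.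
by have <- : l = c by lra.
Qed.

End PowerSums.

(** * From the hypotheses to the threshold, and the theorem *)

Lemma powerSum_rstar kappa Rad g1R rstar :
  (forall j, (0 < j)%N -> 0 <= kappa j) ->
  Rbar_lt 0 Rad -> CV_radius (coef kappa) = Rad -> gbR kappa Rad 1 g1R ->
  is_rstar kappa Rad g1R rstar ->
  exists c : R, [/\ 0 < rstar, Rbar_le rstar Rad,
      forall rho n, 0 < rho < rstar -> powerSum kappa rho n <= 1,
      forall s, rstar < s -> exists J, 1 <= powerSum kappa s J &
      is_lim_seq (powerSum kappa rstar) c /\
      (Rbar_le 1 g1R -> c = 1) /\ (forall c', g1R = Finite c' -> c' < 1 -> c = c')].
Proof.
move=> k0 R0 rad lim [ge1 lt1].
have bdry : Finite rstar = Rad -> Rbar_le g1R 1 -> exists c : R, [/\ 0 < rstar,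
    Rbar_le rstar Rad,
    forall rho n, 0 < rho < rstar -> powerSum kappa rho n <= 1,
    forall s, rstar < s -> exists J, 1 <= powerSum kappa s J &
    is_lim_seq (powerSum kappa rstar) c /\ (Rbar_le 1 g1R -> c = 1) /\
    (forall c', g1R = Finite c' -> c' < 1 -> c = c')].
  move=> Er g_le; rewrite -Er in R0 rad lim.
  have [c [Ec H1 H2 H3]] := powerSum_boundary k0 R0 rad lim g_le.
  exists c; split => //; first by rewrite -Er; exact: Rbar_le_refl.
  split => //; split => [h|c' E _]; last by move: E; rewrite Ec => -[->].
  by rewrite Ec /= in h g_le; lra.
case: (Rbar_lt_le_dec g1R 1) => g1; first by apply: bdry; [exact: lt1 | exact: Rbar_lt_le].
have [r0 [[rR gr]|[Er g1E]]] := ge1 g1; last first.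
  by apply: bdry => //; rewrite g1E; exact: Rbar_le_refl.
rewrite -rad in rR.
have [H1 H2 H3] := powerSum_interior k0 r0 rR gr.
exists 1; split => //; first by rewrite -rad; exact: Rbar_lt_le.
split => //; split => // c' E c'1; move: g1; rewrite E /=; lra.
Qed.

(** In (Sup-0) the convergence of the series of [theta] inside the disc is read off [holo_ext]; in
    the other cases its radius of convergence is given. *)
Lemma hypotheses_radius theta kappa Rad g1R :
  (forall j, (0 < j)%N -> 0 <= theta j) ->
  Hyp_Sub theta kappa Rad g1R \/ Hyp_Sup1 theta kappa Rad g1R \/
  Hyp_Sup0 theta kappa Rad g1R \/ Hyp_Crit1 theta kappa Rad g1R \/
  Hyp_Crit2 theta kappa Rad g1R \/ Hyp_Crit3 theta kappa Rad g1R ->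
  Rbar_lt 0 Rad /\ forall rho, 0 < rho -> Rbar_lt rho Rad ->
  exists T, forall n, \big[Rplus/0]_(1 <= j < n.+1) (theta j * rho ^ j / INR j) <= T.
Proof.
move=> t0.
have radE : CV_radius (coef theta) = Rad -> forall rho, 0 < rho -> Rbar_lt rho Rad ->
    exists T, forall n, \big[Rplus/0]_(1 <= j < n.+1) (theta j * rho ^ j / INR j) <= T.
  by move=> <- rho rho0 rhoR; apply: coef_sum_bounded => //; lra.
case=> [[/radE H [_ [R0 _]]]|]; first by [].
case=> [[Rr [_ [_ [_ [_ [E [R0 [/radE H _]]]]]]]]|]; first by rewrite {1}E.
case=> [|[[/radE H [_ [R0 _]]]|]]; [|by []|]; last first.
  by case=> -[Rr [_ [_ [_ [_ [[E [R0 [/radE H _]]] _]]]]]]; rewrite {1}E.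
case=> Rr [eta [phi [Gth [Gka [E [R0 [_ [_ [_ [c1 [_ [_ H]]]]]]]]]]]].
case: H => s [m [cn [a_s [delta [_ [_ [_ [_ [_ [_ [_ [[_ ps] _]]]]]]]]]]]].
rewrite E; split => // rho rho0 rhoR.
apply: (coef_sum_bounded_C t0 _ (ps (RtoC rho) _)); first lra.
by rewrite Cmod_R Rabs_pos_eq //; lra.
Qed.

Theorem theorem4p2 (theta kappa : nat -> R) (Rad g1R : Rbar) (rstar : R) :
  (forall j : nat, leq 1 j -> 0 <= theta j /\ 0 <= kappa j) ->
  non_arithmetic kappa ->
  (exists j : nat, leq 2 j /\ 0 < kappa j) ->
  CV_radius (coef kappa) = Rad ->
  gbR kappa Rad 1 g1R ->
  is_rstar kappa Rad g1R rstar ->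
  (Hyp_Sub theta kappa Rad g1R \/ Hyp_Sup1 theta kappa Rad g1R \/
   Hyp_Sup0 theta kappa Rad g1R \/ Hyp_Crit1 theta kappa Rad g1R \/
   Hyp_Crit2 theta kappa Rad g1R \/ Hyp_Crit3 theta kappa Rad g1R) ->
  (forall K : nat, leq 1 K ->
     let lK := 1 - sumR [seq kappa j * rstar ^ j | j <- seq.iota 1 K] in
     is_lim_seq (tailmass theta kappa K) lK /\
     LimInf_seq (tailmass theta kappa K) = Finite lK) /\
  (Rbar_le 1 g1R ->
     filterlim (fun K => LimInf_seq (tailmass theta kappa K)) eventually
       (Rbar_locally (Finite 0))) /\
  (forall c : R, g1R = Finite c -> c < 1 ->
     filterlim (fun K => LimInf_seq (tailmass theta kappa K)) eventually
       (Rbar_locally (Finite (1 - c))) /\ 0 < 1 - c).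
Proof.
move=> pos nonar knz rad glim rst hyps.
have t0 j : (0 < j)%N -> 0 <= theta j by case/pos.
have k0 j : (0 < j)%N -> 0 <= kappa j by case/pos.
have [R0 bound] := hypotheses_radius t0 hyps.
have [c [r0 rR below above [climit [c_ge c_lt]]]] := powerSum_rstar k0 R0 rad glim rst.
have tb rho : 0 < rho < rstar ->
    exists T, forall n, \big[Rplus/0]_(1 <= j < n.+1) (theta j * rho ^ j / INR j) <= T.
  move=> [rho0 rho_lt]; apply: bound => //.
  by apply: Rbar_lt_le_trans rR.
have lim K : is_lim_seq (tailmass theta kappa K) (1 - powerSum kappa rstar K).
  exact: (tailmass_lim t0 k0 nonar knz r0 tb below above).
have liminf K : LimInf_seq (tailmass theta kappa K) = Finite (1 - powerSum kappa rstar K).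
  exact/is_LimInf_seq_unique/is_lim_LimInf_seq.
(* The filter consists of the neighbourhoods of the real [1 - c], carried to [Rbar] along [Finite],
   because [LimInf_seq] takes values in [Rbar]. *)
have limK : filterlim (fun K => LimInf_seq (tailmass theta kappa K)) eventually
    (fun P : Rbar -> Prop => Rbar_locally (1 - c) (fun x : R => P x)).
  have h : is_lim_seq (fun K => 1 - powerSum kappa rstar K) (1 - c).
    by apply: is_lim_seq_minus'; [exact: is_lim_seq_const | exact: climit].
  move=> P /h; rewrite /filtermap; apply: filter_imp => K.
  by rewrite liminf.
split.
  move=> K _ lK; suff -> : lK = 1 - powerSum kappa rstar K by [].
  by rewrite /lK sumR_big /powerSum /index_iota subn1.
split=> [/c_ge E|c' E c'1]; first by rewrite E Rminus_diag in limK.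
by rewrite (c_lt c' E c'1) in limK; split => //; lra.
Qed.
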